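(* Let $\mathcal F=\{F_1,\dots,F_\ell\}$ be a finite family of germs of biholomorphisms of $\mathbf C^n$ fixing the origin, whose linear parts $D_m$ at the origin are diagonal, $D_m=\operatorname{diag}(\mu_{m1},\dots,\mu_{mn})$ for $1\le m\le \ell$. If $\mathcal F$ is formally completely integrable and its family of linear parts $\mathcal D=\{D_1,\dots,D_\ell\}$ is of Poincaré type, then $\mathcal F$ is holomorphically completely integrable.
   Context: Notation: $\mathbf N=\{0,1,2,\dots\}$; for $Q\in\mathbf N^n$, $|Q|=q_1+\dots+q_n$ and $\mu_m^{Q}=\mu_{m1}^{q_1}\cdots\mu_{mn}^{q_n}$ (similarly $\mu_m^Q(z)=\mu_{m1}(z)^{q_1}\cdots\mu_{mn}(z)^{q_n}$ for functions). Complete integrability. The family $\mathcal F$ is (resp. formally) completely integrable if there is a germ of biholomorphic (resp. formal biholomorphic) mapping $\Phi$ fixing $0$ such that, with $\hat F_m=\Phi^{-1}F_m\Phi$ $(1\le m\le \ell)$: (i) $\hat F_m(z)=(\mu_{m1}(z)z_1,\dots,\mu_{mn}(z)z_n)$, where the $\mu_{mj}$ are germs of holomorphic (resp. formal) functions such that $\mu_{mj}\circ D_{m'}=\mu_{mj}$ for all $1\le m,m'\le \ell$, $1\le j\le n$; (ii) for each $j$ and each $Q\in\mathbf N^n$ with $|Q|>1$: $\mu_m^Q(0)=\mu_{mj}(0)$ holds for all $m$ if and only if $\mu_m^Q(z)=\mu_{mj}(z)$ holds (identically in $z$) for all $m$. ''Holomorphically completely integrable'' means completely integrable with $\Phi$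 and the $\mu_{mj}$ convergent. Poincaré type. The family $\mathcal D$ is of Poincaré type if there exist constants $d>1$ and $c>0$ such that for each $(j,Q)\in\{1,\dots,n\}\times\mathbf N^n$ satisfying $\mu_m^Q-\mu_{mj}\ne0$ for some $m$, there exists $(i,Q')\in\{1,\dots,\ell\}\times\mathbf N^n$ such that $\mu_k^{Q'}=\mu_k^{Q}$ for all $1\le k\le \ell$, $\mu_i^{Q'}-\mu_{ij}\neq0$, $\max(|\mu_i^{Q'}|,|\mu_i^{-Q'}|)>c^{-1}d^{|Q'|}$, and $Q'-Q\in\mathbf N^n\cup(-\mathbf N^n)$. *)

(* Defs.v *)
From HB Require Import structures.
From mathcomp Require Import all_boot all_order all_algebra.
From mathcomp Require Import reals complex.
From mathcomp Require Export mpoly.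

Set Implicit Arguments.
Unset Strict Implicit.
Unset Printing Implicit Defensive.

Import GRing.Theory Num.Theory.

Local Open Scope ring_scope.

(* Formal power series in z_1, ..., z_n are coefficient families indexed by the
   multi-indices 'X_{1..n}, i.e. N^n, with |Q| = mdeg Q. Germs at 0 of
   holomorphic functions are the convergent ones: a germ is identified with
   its Taylor series, so that the formal and the holomorphic notions share the
   same operations. *)
Definition series (K : Type) (n : nat) : Type := 'X_{1..n} -> K.

Definition smap (K : Type) (n : nat) : Type := 'I_n -> series K n.

Section FormalSeries.
Context {K : comNzRingType} {n : nat}.
Implicit Types (f g : series K n) (F G : smap K n) (P Q : 'X_{1..n}).

Definition sone : series K n := fun Q => (Q == 0%MM)%:R.

Definition svar (j : 'I_n) : series K n := fun Q => (Q == U_(j)%MM)%:R.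

Definition smul f g : series K n := fun Q =>
  \sum_(k : 'X_{1..n < (mdeg Q).+1, (mdeg Q).+1} | Q == (k.1 + k.2)%MM)
     f k.1 * g k.2.

Definition sexp f (k : nat) : series K n := iter k (smul f) sone.

Definition smonom F P : series K n := \big[smul/sone]_(j < n) sexp (F j) (P j).

(* Only meaningful when G has no constant term: (G^P)_Q is then 0 for
   |P| > |Q|, so the sum over |P| <= |Q| is the full one. *)
Definition scomp f G : series K n := fun Q =>
  \sum_(P : 'X_{1..n < (mdeg Q).+1}) f P * smonom G P Q.

Definition smap_comp F G : smap K n := fun j => scomp (F j) G.

Definition linear_part F : 'M[K]_n := \matrix_(i, j) F i U_(j)%MM.

Definition linear_smap (A : 'M[K]_n) : smap K n :=
  fun i Q => \sum_(j < n) A i j * svar j Q.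

Definition fixes_origin F : Prop := forall j, F j 0%MM = 0.

Definition inverse_smaps F G : Prop :=
  smap_comp F G =2 svar /\ smap_comp G F =2 svar.

End FormalSeries.

Section Integrability.
Context {R : realType} {n : nat}.
Local Notation C := R[i].

Definition cmod (x : C) : R := ComplexField.Normc.normc x.

(* Absolute convergence on a neighbourhood of 0: the partial sums of
   \sum_Q |f_Q| r^|Q| are bounded for some r > 0. *)
Definition convergent (f : series C n) : Prop :=
  exists r M : R, 0 < r /\
    forall k, \sum_(Q : 'X_{1..n < k}) cmod (f Q) * r ^+ mdeg Q <= M.

Definition biholomorphic_germ (F : smap C n) : Prop :=
  [/\ fixes_origin F, forall j, convergent (F j)
    & exists G : smap C n, [/\ fixes_origin G, forall j, convergent (G j)
                             & inverse_smaps F G]].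

(* Complete integrability within a class [reg] of series (all of them, or the
   convergent ones). The normal form of F_m is (muhat_{m1}(z) z_1, ...,
   muhat_{mn}(z) z_n), where the value at 0 of muhat_{mj} is the eigenvalue
   mu_{mj} of the linear part D_m of F_m. *)
Definition integrable_in (reg : series C n -> Prop) (l : nat)
    (F : 'I_l -> smap C n) : Prop :=
  exists (Phi Psi : smap C n) (muhat : 'I_l -> smap C n),
  [/\ [/\ fixes_origin Phi, fixes_origin Psi, inverse_smaps Phi Psi
        & forall j, reg (Phi j) /\ reg (Psi j)],
      forall m j, reg (muhat m j) /\ muhat m j 0%MM = linear_part (F m) j j,
      forall m j,
        smap_comp Psi (smap_comp (F m) Phi) j =1 smul (muhat m j) (svar j),
      forall m m' j,
        scomp (muhat m j) (linear_smap (linear_part (F m'))) =1 muhat m j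
    & forall (j : 'I_n) (Q : 'X_{1..n}), (1 < mdeg Q)%N ->
        (forall m, \prod_(i < n) muhat m i 0%MM ^+ Q i = muhat m j 0%MM) <->
        (forall m, smonom (muhat m) Q =1 muhat m j)].

Definition formally_completely_integrable (l : nat)
    (F : 'I_l -> smap C n) : Prop := integrable_in (fun=> True) F.

Definition holomorphically_completely_integrable (l : nat)
    (F : 'I_l -> smap C n) : Prop := integrable_in convergent F.

Definition eigmonom (l : nat) (mu : 'M[C]_(l, n)) (m : 'I_l)
    (Q : 'X_{1..n}) : C := \prod_(j < n) mu m j ^+ Q j.

Definition poincare_type (l : nat) (mu : 'M[C]_(l, n)) : Prop :=
  exists d c : R, [/\ 1 < d, 0 < c &
    forall (j : 'I_n) (Q : 'X_{1..n}),
      (exists m, eigmonom mu m Q - mu m j != 0) ->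
      exists (i : 'I_l) (Q' : 'X_{1..n}),
        [/\ forall k, eigmonom mu k Q' = eigmonom mu k Q,
            eigmonom mu i Q' - mu i j != 0,
            c^-1 * d ^+ mdeg Q' <
              Num.max (cmod (eigmonom mu i Q')) (cmod (eigmonom mu i Q')^-1)
          & (Q <= Q')%MM \/ (Q' <= Q)%MM]].

End Integrability.

(* Main.v *)
Require Import Defs.
From HB Require Import structures.
From mathcomp Require Import all_boot all_order all_algebra.
From mathcomp Require Import boolp reals complex zify ring lra.

(** Write mu_m^Q for the eigenvalue monomials, call (j, Q) resonant when
    mu_m^Q = mu_mj for all m, and call P invariant when mu_m^P = 1 for all m.
    A formal normalizing map Phi is far from unique; the proof selects one with
    as few monomials as possible and shows that it converges by the method of
    majorants.

    Normalization.  Let chi be the resonant part of Phi.  By the resonance clause of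
    complete integrability a resonant monomial z^Q satisfies
    z^Q o F^_m = nu_mj z^Q, where F^_m = (nu_mj z_j)_j is the normal form, so
    chi_j o F^_m = nu_mj chi_j.  Hence Phi o chi^-1 also normalizes the family,
    with nu replaced by nu o chi^-1, and its only resonant terms are the
    z_j (nonresonant_normalization).

    Coefficients.  The same clause gives nu_m^P = 1 for every invariant P, so
    nu_m^Q depends on Q only up to addition of invariant exponents, and the
    equation F_m o Phi = Phi o F^_m at the monomial z^Q reads
    [nu_m^Q Phi_j]_Q = mu_mj [Phi_j]_Q + [f_m,j o Phi]_Q, with f_m the
    nonlinear part of F_m (conjugacy_coef).  At resonant Q this determines the
    nonconstant part of nu_mj from f_m,j o Phi.  At nonresonant Q the Poincare
    condition supplies i and Q' comparable to Q, so nu_i^Q = nu_i^Q', for which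
    mu_i^Q' is either very small or very large and the divisor mu_i^Q' - mu_ij
    stays away from 0 (small_divisor_bound).

    Majorants.  The growth d^|Q'| provided by the Poincare condition absorbs
    the exponent Q': if rho majorizes all nu_mj / mu_mj - 1, then
    tau = 1 + rho tau / (1 - 1/d) satisfies
    (nu_i / mu_i)^(+-Q') << d^|Q'| tau, with a tau that does not depend on Q'.
    This yields an inequality |Phi_j| << z_j + C (tau g_j + (tau - 1) |Phi_j|)
    with g_j the sum of the |f_m,j o Phi| (key_inequality).

    Convergence.  Since f_m, tau - 1 and Phi have orders 2, 1 and 1, the
    coefficients of degree k on the right only involve lower ones of Phi, and
    for r small the partial sums of Phi at (r, .., r) stay below 2 r by
    induction on k (bootstrap).  The convergence of nu comes along, and that of
    the inverse of Phi follows from the same estimate (convergent_inverse). *)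

Set Implicit Arguments.
Unset Strict Implicit.
Unset Printing Implicit Defensive.

Import Order.TTheory GRing.Theory Num.Theory.

Local Open Scope ring_scope.

(** * The ring of formal power series *)

Section SeriesRing.
Context {K : comNzRingType} {n : nat}.
Implicit Types (f g h : series K n) (P Q : 'X_{1..n}).

HB.instance Definition _ := gen_eqMixin (series K n).
HB.instance Definition _ := gen_choiceMixin (series K n).

Let sadd f g : series K n := fun Q => f Q + g Q.
Let sopp f : series K n := fun Q => - f Q.
Let szero : series K n := fun=> 0.

Let saddA : associative sadd.
Proof. by move=> f g h; apply/funext => Q; rewrite /sadd addrA. Qed.
Let saddC : commutative sadd.
Proof. by move=> f g; apply/funext => Q; rewrite /sadd addrC. Qed.
Let sadd0 : left_id szero sadd.
Proof. by move=> f; apply/funext => Q; rewrite /sadd add0r. Qed.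
Let saddN : left_inverse szero sopp sadd.
Proof. by move=> f; apply/funext => Q; rewrite /sadd addNr. Qed.

HB.instance Definition _ :=
  GRing.isZmodule.Build (series K n) saddA saddC sadd0 saddN.

Lemma saddE f g Q : (f + g) Q = f Q + g Q. Proof. by []. Qed.
Lemma soppE f Q : (- f) Q = - f Q. Proof. by []. Qed.
Lemma szeroE Q : (0 : series K n) Q = 0. Proof. by []. Qed.
Lemma ssumE I (r : seq I) (p : pred I) (F : I -> series K n) Q :
  (\sum_(i <- r | p i) F i) Q = \sum_(i <- r | p i) F i Q.
Proof. by elim/big_rec2: _ => // i a b _ <-. Qed.

(** The coefficients of degree below k of a product of series are those of the
    product of the truncated polynomials; the ring axioms are transported from
    multivariate polynomials along this fact. *)
Definition trunc k f : {mpoly K[n]} :=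
  \sum_(Q : 'X_{1..n < k}) f Q *: 'X_[Q].

Lemma mcoeff_trunc k f Q : (mdeg Q < k)%N -> (trunc k f)@_Q = f Q.
Proof. exact: mcoeff_mpoly. Qed.

Lemma smulE k f g Q : (mdeg Q < k)%N ->
  smul f g Q = (trunc k f * trunc k g)@_Q.
Proof.
move=> ltQ; rewrite mcoeffM; apply: eq_bigr => -[P1 P2] _ /=.
by rewrite !mcoeff_trunc ?(leq_trans (bmdeg _)).
Qed.

Lemma eq_low_mcoeffM k (p p' q q' : {mpoly K[n]}) Q : (mdeg Q < k)%N ->
  (forall P, (mdeg P < k)%N -> p@_P = p'@_P) ->
  (forall P, (mdeg P < k)%N -> q@_P = q'@_P) ->
  (p * q)@_Q = (p' * q')@_Q.
Proof.
move=> ltQ pp' qq'; rewrite !mcoeffM; apply: eq_bigr => -[P1 P2] _ /=.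
by rewrite pp' ?qq' // (leq_trans (bmdeg _)).
Qed.

Lemma mcoeff_trunc_smul k f g Q : (mdeg Q < k)%N ->
  (trunc k (smul f g))@_Q = (trunc k f * trunc k g)@_Q.
Proof. by move=> ltQ; rewrite mcoeff_trunc // (smulE _ _ ltQ). Qed.

Let smulA : associative (@smul K n).
Proof.
move=> f g h; apply/funext => Q; have lt := ltnSn (mdeg Q).
rewrite !(smulE _ _ lt); transitivity
  (trunc (mdeg Q).+1 f * (trunc (mdeg Q).+1 g * trunc (mdeg Q).+1 h))@_Q.
  by apply: eq_low_mcoeffM lt _ _ => // P ltP; rewrite mcoeff_trunc_smul.
rewrite mulrA; apply: eq_low_mcoeffM lt _ _ => // P ltP.
by rewrite mcoeff_trunc_smul.
Qed.

Let smulC : commutative (@smul K n).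
Proof.
by move=> f g; apply/funext => Q; rewrite !(smulE _ _ (ltnSn _)) mulrC.
Qed.

Let smul1 : left_id (@sone K n) smul.
Proof.
move=> f; apply/funext => Q; rewrite (smulE _ _ (ltnSn _)).
rewrite -[RHS](mcoeff_trunc _ (ltnSn _)) -[in RHS](mul1r (trunc _ f)).
apply: (eq_low_mcoeffM (ltnSn _)) => // P ltP.
by rewrite mcoeff_trunc // mcoeff1.
Qed.

Let smulD : left_distributive (@smul K n) +%R.
Proof.
move=> f g h; apply/funext => Q; rewrite saddE !(smulE _ _ (ltnSn _)).
rewrite -mcoeffD -mulrDl; apply: (eq_low_mcoeffM (ltnSn _)) => // P ltP.
by rewrite mcoeffD !mcoeff_trunc.
Qed.

Let sone_neq0 : @sone K n != 0.
Proof.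
apply/eqP => /(congr1 (fun f => f 0%MM)); rewrite /sone eqxx szeroE.
exact/eqP/oner_neq0.
Qed.

HB.instance Definition _ := GRing.Zmodule_isComNzRing.Build (series K n)
  smulA smulC smul1 smulD sone_neq0.

Let sscale (c : K) f : series K n := fun Q => c * f Q.
Let sscaleA a b f : sscale a (sscale b f) = sscale (a * b) f.
Proof. by apply/funext => Q; rewrite /sscale mulrA. Qed.
Let sscale1 : left_id 1 sscale.
Proof. by move=> f; apply/funext => Q; rewrite /sscale mul1r. Qed.
Let sscaleDr : right_distributive sscale +%R.
Proof. by move=> a f g; apply/funext => Q; rewrite /sscale mulrDr. Qed.
Let sscaleDl f : {morph sscale^~ f : a b / a + b}.
Proof. by move=> a b; apply/funext => Q; rewrite /sscale mulrDl. Qed.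

HB.instance Definition _ := GRing.Zmodule_isLmodule.Build K (series K n)
  sscaleA sscale1 sscaleDr sscaleDl.

Lemma sscaleE (c : K) f Q : (c *: f) Q = c * f Q. Proof. by []. Qed.

Lemma smul_mulr f g : smul f g = f * g. Proof. by []. Qed.

Lemma smulM k f g Q : (mdeg Q < k)%N ->
  (f * g) Q = \sum_(P : 'X_{1..n < k} | (P <= Q)%MM) f P * g (Q - P)%MM.
Proof.
move=> ltQ; rewrite -smul_mulr (smulE _ _ ltQ) (mcoeff_poly_mul_lin _ _ ltQ).
apply: eq_bigr => P _; rewrite !mcoeff_trunc ?bmdeg //.
exact: leq_ltn_trans (mdegB _ _) ltQ.
Qed.

Lemma smulM2 k f g Q : (mdeg Q < k)%N ->
  (f * g) Q = \sum_(P : 'X_{1..n < k, k} | Q == (P.1 + P.2)%MM) f P.1 * g P.2.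
Proof.
move=> ltQ; rewrite -smul_mulr (smulE _ _ ltQ) (mcoeff_poly_mul _ _ ltQ).
by apply: eq_bigr => -[P1 P2] _; rewrite !mcoeff_trunc ?bmdeg.
Qed.

Lemma sscaleAl (c : K) f g : c *: (f * g) = c *: f * g.
Proof.
apply/funext => Q; rewrite sscaleE !(smulM _ _ (ltnSn _)) mulr_sumr.
by apply: eq_bigr => P _; rewrite mulrA.
Qed.

Lemma sscaleAr (c : K) f g : c *: (f * g) = f * (c *: g).
Proof. by rewrite mulrC sscaleAl mulrC. Qed.

Lemma sexpE f k : sexp f k = f ^+ k.
Proof. by elim: k => //= k IHk; rewrite exprS -IHk. Qed.

Lemma smonomE (F : smap K n) P : smonom F P = \prod_(j < n) F j ^+ P j.
Proof. by apply: eq_bigr => j _; rewrite sexpE. Qed.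

Lemma smonom0 (F : smap K n) : smonom F 0%MM = 1.
Proof. by rewrite smonomE big1 // => j _; rewrite mnm0E. Qed.

Lemma smonomD (F : smap K n) P Q :
  smonom F (P + Q)%MM = smonom F P * smonom F Q.
Proof.
by rewrite !smonomE -big_split; apply: eq_bigr => j _; rewrite mnmDE exprD.
Qed.

Lemma smonomU (F : smap K n) i : smonom F U_(i)%MM = F i.
Proof.
rewrite smonomE (bigD1 i) //= big1 ?mulr1 => [|j ji]; rewrite mnm1E.
  by rewrite eqxx.
by rewrite eq_sym (negPf ji).
Qed.

Lemma sone_E Q : (1 : series K n) Q = (Q == 0%MM)%:R.
Proof. by []. Qed.

End SeriesRing.

(** * Order at the origin and composition *)

Section Order.
Context {K : comNzRingType} {n : nat}.
Implicit Types (f g h : series K n) (Q : 'X_{1..n}) (F G H : smap K n).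

Lemma sum_bmnm_sub (V : nmodType) (a : 'X_{1..n} -> V) k0 k : (k0 <= k)%N ->
  \sum_(P : 'X_{1..n < k0}) a P =
  \sum_(P : 'X_{1..n < k} | (mdeg P < k0)%N) a P.
Proof.
move=> le_k; pose w (P : 'X_{1..n < k0}) : 'X_{1..n < k} :=
  BMultinom (leq_trans (bmdeg P) le_k).
have winj : injective w by move=> P P' /(congr1 val) /= h; apply: val_inj.
rewrite (partition_big w (fun P : 'X_{1..n < k} => (mdeg P < k0)%N)) //=;
  last first.
  by move=> P _; rewrite bmdeg.
apply: eq_bigr => P ltP.
by rewrite (big_pred1 (BMultinom ltP)).
Qed.

Lemma sum_bmnm_widen (V : nmodType) (a : 'X_{1..n} -> V) k0 k : (k0 <= k)%N ->
  (forall P, (k0 <= mdeg P)%N -> a P = 0) ->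
  \sum_(P : 'X_{1..n < k0}) a P = \sum_(P : 'X_{1..n < k}) a P.
Proof.
move=> le_k a0; rewrite (sum_bmnm_sub _ le_k).
rewrite [RHS](bigID (fun P : 'X_{1..n < k} => (mdeg P < k0)%N)) /=.
by rewrite [X in _ = _ + X]big1 ?addr0 // => P; rewrite -leqNgt => /a0.
Qed.

Definition order_ge k f := forall Q, (mdeg Q < k)%N -> f Q = 0.

Lemma order_ge0 f : order_ge 0 f. Proof. by []. Qed.
Lemma order_geW k k' f : (k' <= k)%N -> order_ge k f -> order_ge k' f.
Proof. by move=> le_k fk Q ltQ; apply: fk; apply: leq_trans le_k. Qed.
Lemma order_geD k f g : order_ge k f -> order_ge k g -> order_ge k (f + g).
Proof. by move=> fk gk Q ltQ; rewrite saddE fk ?gk ?addr0. Qed.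
Lemma order_geN k f : order_ge k f -> order_ge k (- f).
Proof. by move=> fk Q ltQ; rewrite soppE fk ?oppr0. Qed.
Lemma order_geZ k c f : order_ge k f -> order_ge k (c *: f).
Proof. by move=> fk Q ltQ; rewrite sscaleE fk ?mulr0. Qed.
Lemma order_ge_sum k I (r : seq I) (p : pred I) (X : I -> series K n) :
  (forall i, p i -> order_ge k (X i)) -> order_ge k (\sum_(i <- r | p i) X i).
Proof. by move=> Xk; apply: big_ind => //; apply: order_geD. Qed.
Lemma order_geM a b f g :
  order_ge a f -> order_ge b g -> order_ge (a + b) (f * g).
Proof.
move=> fa gb Q ltQ; rewrite (smulM _ _ (ltnSn _)) big1 // => P leP.
have [ltP|leP'] := ltnP (mdeg P) a; first by rewrite fa ?mul0r.
rewrite gb ?mulr0 //; move: ltQ.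
by rewrite -{1}(submK leP) mdegD addnC; lia.
Qed.
Lemma order_geMl a f g : order_ge a g -> order_ge a (f * g).
Proof. by move=> ga; rewrite -[a]add0n; apply: order_geM. Qed.
Lemma order_geX a k f : order_ge a f -> order_ge (a * k) (f ^+ k).
Proof.
by move=> fa; elim: k => [|k IHk]; rewrite ?muln0 // exprS mulnS; apply: order_geM.
Qed.

Lemma fixes_originP F : fixes_origin F <-> forall j, order_ge 1 (F j).
Proof.
split=> [F0 i Q|F1 i]; last by apply: F1; rewrite mdeg0.
by rewrite ltnS leqn0 mdeg_eq0 => /eqP ->.
Qed.

(** This is what makes the finite sum defining the composition the full one. *)
Lemma order_ge_smonom F P : fixes_origin F -> order_ge (mdeg P) (smonom F P).
Proof.
move=> F0; rewrite smonomE mdegE.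
apply: (big_rec2 (fun k f => order_ge k f)) => // j k f _ fk.
apply: order_geM => //; rewrite -{1}[P j]mul1n.
by apply: order_geX; move/fixes_originP: F0; apply.
Qed.

Lemma scompE k f G Q : fixes_origin G -> (mdeg Q < k)%N ->
  scomp f G Q = \sum_(P : 'X_{1..n < k}) f P * smonom G P Q.
Proof.
move=> G0 ltQ; rewrite /scomp.
apply: (sum_bmnm_widen (a := fun P => f P * smonom G P Q)) => // P ltP.
by rewrite order_ge_smonom ?mulr0.
Qed.

Lemma scomp0 f G : scomp f G 0%MM = f 0%MM.
Proof.
rewrite /scomp mdeg0 (bigD1 bm0) //= smonom0 sone_E eqxx mulr1 big1 ?addr0 //.
move=> P P0; suff : P = bm0 by move/eqP; rewrite (negPf P0).
apply: val_inj => /=; apply/eqP; rewrite -mdeg_eq0 -leqn0 -ltnS.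
by rewrite bmdeg.
Qed.

Lemma fixes_origin_comp F G :
  fixes_origin F -> fixes_origin (smap_comp F G).
Proof. by move=> F0 j; rewrite /smap_comp scomp0 F0. Qed.

Lemma scompD f g G : scomp (f + g) G = scomp f G + scomp g G.
Proof.
apply/funext => Q; rewrite saddE /scomp -big_split /=.
by apply: eq_bigr => P _; rewrite saddE mulrDl.
Qed.

Lemma scompZ c f G : scomp (c *: f) G = c *: scomp f G.
Proof.
apply/funext => Q; rewrite sscaleE /scomp mulr_sumr.
by apply: eq_bigr => P _; rewrite sscaleE mulrA.
Qed.

Lemma scompN f G : scomp (- f) G = - scomp f G.
Proof. by rewrite -scaleN1r scompZ scaleN1r. Qed.

Lemma scompB f g G : scomp (f - g) G = scomp f G - scomp g G.
Proof. by rewrite scompD scompN. Qed.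

Lemma scomp_sum I (r : seq I) (p : pred I) (X : I -> series K n) G :
  scomp (\sum_(i <- r | p i) X i) G = \sum_(i <- r | p i) scomp (X i) G.
Proof.
apply: (big_morph (fun f => scomp f G)) => [f g|]; first exact: scompD.
by rewrite -(scale0r (0 : series K n)) scompZ !scale0r.
Qed.

Definition smon (P : 'X_{1..n}) : series K n := fun Q => (Q == P)%:R.

Lemma scomp_smon P G : fixes_origin G -> scomp (smon P) G = smonom G P.
Proof.
move=> G0; apply/funext => Q.
have ltQ : (mdeg Q < (maxn (mdeg P) (mdeg Q)).+1)%N by rewrite ltnS leq_maxr.
have ltP : (mdeg P < (maxn (mdeg P) (mdeg Q)).+1)%N by rewrite ltnS leq_maxl.
rewrite (scompE _ G0 ltQ) (bigD1 (BMultinom ltP)) //= /smon eqxx mul1r.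
rewrite big1 ?addr0 // => P' /negPf; rewrite -val_eqE /= => ->.
by rewrite mul0r.
Qed.

Lemma smon0 : smon 0%MM = 1. Proof. by []. Qed.

Lemma smonU i : smon U_(i)%MM = svar i. Proof. by []. Qed.

Lemma scomp1 G : fixes_origin G -> scomp 1 G = 1.
Proof. by move=> G0; rewrite -smon0 scomp_smon // smonom0. Qed.

Lemma scomp_svar i G : fixes_origin G -> scomp (svar i) G = G i.
Proof. by move=> G0; rewrite -smonU scomp_smon // smonomU. Qed.

Lemma scomp_low k f f' G :
  order_ge k (f - f') -> order_ge k (scomp f G - scomp f' G).
Proof.
move=> ff' Q ltQ; rewrite -scompB /scomp big1 // => P _.
by rewrite ff' ?mul0r // (leq_trans (bmdeg P)).
Qed.

(** Both sides expand to the sum of f_A g_B [G^(A + B)]_Q over the pairs (A, B);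
    the pairs with A + B of degree above that of Q contribute nothing. *)
Lemma scompM f g G : fixes_origin G ->
  scomp (f * g) G = scomp f G * scomp g G.
Proof.
move=> G0; apply/funext => Q; have ltQ := ltnSn (mdeg Q).
set k := (mdeg Q).+1 in ltQ *.
transitivity (\sum_(P : 'X_{1..n < k, k})
   f P.1 * g P.2 * (smonom G (P.1 + P.2)%MM) Q).
  rewrite (scompE _ G0 ltQ).
  under eq_bigr => S _ do rewrite (smulM2 f g (bmdeg S)) mulr_suml.
  rewrite (exchange_big_dep xpredT) //=; apply: eq_bigr => -[P1 P2] _ /=.
  have [ltP|leP] := ltnP (mdeg (P1 + P2)%MM) k.
    rewrite (big_pred1 (BMultinom ltP)) //= => S /=.
  rewrite order_ge_smonom // mulr0 big1 // => S /eqP eS.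
  by rewrite eS order_ge_smonom ?mulr0.
rewrite (smulM2 _ _ ltQ).
under [RHS]eq_bigr => A _.
  rewrite (scompE _ G0 (bmdeg A.1)) (scompE _ G0 (bmdeg A.2)) big_distrlr /=.
  rewrite pair_big /=.
  over.
rewrite exchange_big; apply: eq_bigr => -[P1 P2] _ /=.
rewrite smonomD (smulM2 _ _ ltQ) mulr_sumr; apply: eq_bigr => A _ /=.
by rewrite mulrACA.
Qed.

Lemma scompX f k G : fixes_origin G -> scomp (f ^+ k) G = scomp f G ^+ k.
Proof.
by move=> G0; elim: k => [|k IHk]; rewrite ?scomp1 // !exprS scompM ?IHk.
Qed.

Lemma scomp_smonom F G P : fixes_origin G ->
  scomp (smonom F P) G = smonom (smap_comp F G) P.
Proof.
move=> G0; rewrite !smonomE.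
rewrite (big_morph (fun f => scomp f G)
  (fun f g => scompM f g G0) (scomp1 G0)).
by apply: eq_bigr => j _; rewrite scompX.
Qed.

Lemma scomp_trunc k f G : fixes_origin G ->
  order_ge k (scomp f G - \sum_(P : 'X_{1..n < k}) f P *: smonom G P).
Proof.
by move=> G0 Q ltQ; rewrite saddE soppE (scompE _ G0 ltQ) ssumE subrr.
Qed.

Lemma series_eqP f g : (forall k, order_ge k (f - g)) -> f = g.
Proof.
move=> fg; apply/funext => Q; apply/eqP; rewrite -subr_eq0; apply/eqP.
exact: (fg _ Q (ltnSn _)).
Qed.

Lemma order_ge_trans k f g h :
  order_ge k (f - g) -> order_ge k (g - h) -> order_ge k (f - h).
Proof. by move=> fg gh; rewrite -(subrKA g); apply: order_geD. Qed.

Lemma order_ge_sym k f g : order_ge k (f - g) -> order_ge k (g - f).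
Proof. by move=> fg; rewrite -opprB; apply: order_geN. Qed.

(** Modulo order k, the series f o F is a finite combination of monomials F^P,
    and composition with G is a ring morphism. *)
Lemma scompA f F G : fixes_origin F -> fixes_origin G ->
  scomp (scomp f F) G = scomp f (smap_comp F G).
Proof.
move=> F0 G0; apply: series_eqP => k.
apply: order_ge_trans (scomp_low G (scomp_trunc f F0)) _.
rewrite scomp_sum; under eq_bigr => P _ do rewrite scompZ scomp_smonom //.
exact/order_ge_sym/scomp_trunc/fixes_origin_comp.
Qed.

(** With G the identity map: if substituting F multiplies every monomial of f by
    one and the same series u, it multiplies f by u. *)
Lemma scomp_factor f u F G : fixes_origin F -> fixes_origin G ->
  (forall P, f P != 0 -> smonom F P = u * smonom G P) ->
  scomp f F = u * scomp f G.
Proof.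
move=> F0 G0 FG; apply: series_eqP => k.
apply: order_ge_trans (scomp_trunc f F0) _.
rewrite (eq_bigr (fun P : 'X_{1..n < k} => u * (f P *: smonom G P))).
  rewrite -mulr_sumr -mulrBr.
  exact/order_geMl/order_ge_sym/scomp_trunc.
move=> P _; have [->|fP] := eqVneq (f P) 0; first by rewrite !scale0r mulr0.
by rewrite FG // sscaleAr.
Qed.

Lemma smonD P Q : smon (P + Q)%MM = smon P * smon Q.
Proof.
apply/funext => S; pose k := (mdeg S + mdeg P + mdeg Q).+1.
rewrite (smulM2 _ _ (_ : mdeg S < k)%N); last by rewrite /k; lia.
have ltP : (mdeg P < k)%N by rewrite /k; lia.
have ltQ : (mdeg Q < k)%N by rewrite /k; lia.
rewrite big_mkcond (bigD1 (BMultinom ltP, BMultinom ltQ)) //= /smon !eqxx mulr1.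
rewrite big1 ?addr0 => [|[A B] /=]; first by case: ifP.
rewrite xpair_eqE -!val_eqE /= => /nandP[] /negPf ->.
  by rewrite mul0r; case: ifP.
by rewrite mulr0; case: ifP.
Qed.

Lemma smonom_svar P : smonom svar P = smon P.
Proof.
rewrite smonomE [in RHS](multinomUE_id P).
rewrite (big_morph smon smonD smon0); apply: eq_bigr => j _.
elim: (P j) => [|k IHk]; first by rewrite mulm0n.
by rewrite exprS IHk mulmS smonD.
Qed.

Lemma scomp_id f : scomp f svar = f.
Proof.
apply/funext => Q; rewrite /scomp (bigD1 (BMultinom (ltnSn (mdeg Q)))) //=.
rewrite smonom_svar /smon eqxx mulr1 big1 ?addr0 // => P.
rewrite -val_eqE /= => /negPf PQ.
by rewrite smonom_svar /smon eq_sym PQ mulr0.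
Qed.

Lemma smul_smon f P Q : (f * smon P) (Q + P)%MM = f Q.
Proof.
rewrite (smulM _ _ (ltnSn _)).
have ltQ : (mdeg Q < (mdeg (Q + P)%MM).+1)%N by rewrite mdegD; lia.
rewrite (bigD1 (BMultinom ltQ)) ?lem_addr //=.
have -> : (Q + P - Q)%MM = P by rewrite [(Q + _)%MM]addmC addmK.
rewrite [smon P P]/smon eqxx mulr1.
rewrite big1 ?addr0 // => A /andP[leA]; rewrite -val_eqE /= => nAQ.
rewrite /smon [_ == _](_ : _ = false) ?mulr0 //; apply/negbTE.
apply: contra nAQ => /eqP e; move: (submK leA).
by rewrite e addmC => /addIm ->.
Qed.

Lemma smul_smon0 f P Q : ~~ (P <= Q)%MM -> (f * smon P) Q = 0.
Proof.
move=> nPQ; rewrite (smulM _ _ (ltnSn _)) big1 // => A leA.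
rewrite /smon; case: eqP => [e|]; rewrite ?mulr0 //.
by rewrite -e lem_subr in nPQ.
Qed.

End Order.

(** * Formal inverses *)

Section FormalInverse.
Context {K : comNzRingType} {n : nat}.
Implicit Types (f g h : series K n) (Q : 'X_{1..n}) (F G H : smap K n).

Lemma mnm_ind (p : 'X_{1..n} -> Prop) :
  p 0%MM -> (forall i Q, p Q -> p (U_(i) + Q)%MM) -> forall Q, p Q.
Proof.
move=> p0 pS Q; rewrite (multinomUE_id Q).
apply: (big_rec p) => // i Q' _ pQ'.
by elim: (Q i) => [|k IHk]; rewrite ?mulm0n ?add0m // mulmS -addmA; apply: pS.
Qed.

Lemma mdeg_gt0P (P : 'X_{1..n}) : (0 < mdeg P)%N -> exists j, (0 < P j)%N.
Proof.
move=> P0; apply/existsP; apply: contraTT P0; rewrite negb_exists => /forallP P0.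
by rewrite mdegE big1 // => j _; have := P0 j; case: (P j).
Qed.

Lemma mdeg_subm_lt (P Q : 'X_{1..n}) :
  (P <= Q)%MM -> (0 < mdeg P)%N -> (mdeg (Q - P)%MM < mdeg Q)%N.
Proof. by move=> lePQ P0; rewrite -[in X in (_ < X)%N](submK lePQ) mdegD; lia. Qed.

(** The other factors of the monomial vanish at 0, and each of them raises the
    order of the error by one. *)
Lemma smonom_low k F G P : fixes_origin F -> fixes_origin G ->
  (forall j, order_ge k (F j - G j)) ->
  order_ge (k + (mdeg P).-1) (smonom F P - smonom G P).
Proof.
move=> F0 G0 FG; elim/mnm_ind: P => [|i P IHP].
  by rewrite !smonom0 subrr.
rewrite !smonomD !smonomU mdegD mdeg1 add1n /=.
have -> : F i * smonom F P - G i * smonom G P =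
  (F i - G i) * smonom F P + G i * (smonom F P - smonom G P) by ring.
apply: order_geD; first by apply: order_geM => //; apply: order_ge_smonom.
apply: order_geW (order_geM ((fixes_originP G).1 G0 i) IHP); lia.
Qed.

Lemma scomp_low_r k f F G : fixes_origin F -> fixes_origin G ->
  order_ge 2 f -> (forall j, order_ge k (F j - G j)) ->
  order_ge k.+1 (scomp f F - scomp f G).
Proof.
move=> F0 G0 f2 FG Q ltQ; rewrite saddE soppE /scomp -sumrB big1 // => P _.
rewrite -mulrBr; have [ltP|leP] := ltnP (mdeg P) 2; first by rewrite f2 ?mul0r.
have := smonom_low (P := P) F0 G0 FG.
by rewrite /order_ge => /(_ Q); rewrite saddE soppE => ->; rewrite ?mulr0 //; lia.
Qed.

Lemma order_ge_scomp k f G : fixes_origin G ->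
  order_ge k f -> order_ge k (scomp f G).
Proof.
move=> G0 fk Q ltQ; rewrite /scomp big1 // => P _.
by rewrite fk ?mul0r // (leq_trans (bmdeg P)).
Qed.

Definition nonlinear_part f : series K n :=
  f - f 0%MM *: (1 : series K n) - \sum_(i < n) f U_(i)%MM *: svar i.

Lemma svarE i Q : svar i Q = (Q == U_(i)%MM)%:R :> K. Proof. by []. Qed.

Lemma order_ge_nonlinear_part f : order_ge 2 (nonlinear_part f).
Proof.
move=> Q; rewrite /nonlinear_part !saddE !soppE ssumE sscaleE sone_E.
under eq_bigr => i _ do rewrite sscaleE svarE.
rewrite ltnS leq_eqVlt => /orP[|]; last first.
  rewrite ltnS leqn0 mdeg_eq0 => /eqP ->; rewrite eqxx mulr1 subrr sub0r.
  by rewrite big1 ?oppr0 // => i _; rewrite eq_sym mnm1_eq0 mulr0.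
move=> /mdeg1P[i /eqP ->]; rewrite mnm1_eq0 mulr0 subr0.
rewrite (bigD1 i) //= eqxx mulr1 big1 ?addr0 ?subrr // => j ji.
rewrite [_ == _](_ : _ = false) ?mulr0 //; apply/negbTE; apply: contra ji => /eqP.
by move=> /(congr1 (fun m : 'X_{1..n} => m j)); rewrite !mnm1E eqxx; case: eqP => // ->.
Qed.

Lemma nonlinear_partE f :
  f = f 0%MM *: (1 : series K n) + \sum_(i < n) f U_(i)%MM *: svar i
    + nonlinear_part f.
Proof. by rewrite /nonlinear_part; ring. Qed.

Lemma scomp_nonlinear_part f G : fixes_origin G ->
  scomp f G = f 0%MM *: (1 : series K n) + \sum_(i < n) f U_(i)%MM *: G i
    + scomp (nonlinear_part f) G.
Proof.
move=> G0; rewrite {1}(nonlinear_partE f).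
rewrite !scompD scompZ scomp1 // scomp_sum; congr (_ + _ + _).
by apply: eq_bigr => i _; rewrite scompZ scomp_svar.
Qed.

Lemma scomp_linear f G i : fixes_origin G ->
  scomp f G U_(i)%MM = \sum_(j < n) f U_(j)%MM * G j U_(i)%MM.
Proof.
move=> G0; rewrite scomp_nonlinear_part // !saddE sscaleE sone_E mnm1_eq0 mulr0 add0r.
rewrite (order_ge_scomp G0 (order_ge_nonlinear_part f)) ?mdeg1 // addr0 ssumE.
by apply: eq_bigr.
Qed.

Definition supported (S : 'X_{1..n} -> Prop) f := forall Q, f Q != 0 -> S Q.

(** If the terms of degree k of T y are determined by the terms of y of lower
    degree, the iterates of T stabilize degree by degree.  The supports S are
    carried along, which later keeps track of resonances. *)
Lemma causal_fixpoint (I : Type) (S : I -> 'X_{1..n} -> Prop)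
    (T : (I -> series K n) -> I -> series K n) :
  (forall y, (forall i, supported (S i) (y i)) ->
     forall i, supported (S i) (T y i)) ->
  (forall k y y', (forall i, supported (S i) (y i)) ->
     (forall i, supported (S i) (y' i)) ->
     (forall i, order_ge k (y i - y' i)) ->
     forall i, order_ge k.+1 (T y i - T y' i)) ->
  exists y, (forall i, supported (S i) (y i)) /\ forall i, y i = T y i.
Proof.
move=> TS Tcausal; pose u k := iter k T (fun=> 0).
have uS k i : supported (S i) (u k i).
  elim: k i => [|k IHk] i; last exact: TS.
  by move=> Q; rewrite /u /= szeroE eqxx.
have uk k i : order_ge k (u k i - u k.+1 i).
  by elim: k i => [|k IHk] i; last exact: (Tcausal k (u k) (u k.+1)).
have ukm k m i Q : (mdeg Q < k)%N -> u (k + m)%N i Q = u k i Q.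
  move=> ltQ; elim: m => [|m IHm]; rewrite ?addn0 // addnS -IHm.
  apply/esym/eqP; rewrite -subr_eq0; apply/eqP.
  by apply: (uk (k + m)%N i Q); lia.
pose y i : series K n := fun Q => u (mdeg Q).+1 i Q.
have yu k i : order_ge k (y i - u k i).
  move=> Q ltQ; rewrite saddE soppE /y -(subnKC ltQ) ukm //.
  by rewrite subrr.
have yS i : supported (S i) (y i) by move=> Q; apply: uS.
exists y; split=> // i; apply/funext => Q.
have := Tcausal _ _ _ yS (uS (mdeg Q)) (yu (mdeg Q)) i Q (ltnSn _).
by rewrite saddE soppE => /eqP; rewrite subr_eq0 => /eqP ->.
Qed.

Lemma geometric_series (S : 'X_{1..n} -> Prop) h : order_ge 1 h ->
  (forall y, supported S y -> supported S (1 + h * y)) ->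
  exists y, supported S y /\ y = 1 + h * y.
Proof.
move=> h1 hS.
have [|k y y' _ _ yy' _|y [yS yE]] := @causal_fixpoint unit (fun=> S)
  (fun y _ => 1 + h * y tt).
- by move=> y yS _; apply: hS.
- have -> : 1 + h * y tt - (1 + h * y' tt) = h * (y tt - y' tt) by ring.
  by rewrite -add1n; apply: order_geM.
- by exists (y tt); split => //; apply: yE.
Qed.

(** The fixed point of G = B (z - f(G)), where f is the nonlinear part of F. *)
Lemma formal_right_inverse (S : 'I_n -> 'X_{1..n} -> Prop) F (B : 'M[K]_n) :
  fixes_origin F -> linear_part F *m B = 1%:M ->
  (forall j, ~ S j 0%MM) ->
  (forall G, (forall j, supported (S j) (G j)) -> forall j,
     supported (S j) (\sum_i B j i *: (svar i - scomp (nonlinear_part (F i)) G))) ->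
  exists G, [/\ forall j, supported (S j) (G j), fixes_origin G &
     smap_comp F G =2 svar].
Proof.
move=> F0 AB S0 TS.
have Sfix G : (forall j, supported (S j) (G j)) -> fixes_origin G.
  by move=> GS j; apply/eqP; apply: contra_notT (S0 j) => /GS.
have [k y y' yS y'S yy' j|G [GS GE]] := causal_fixpoint
  (T := fun G j => \sum_i B j i *: (svar i - scomp (nonlinear_part (F i)) G)) TS.
  rewrite -sumrB; apply: order_ge_sum => i _; rewrite -scalerBr.
  apply: order_geZ.
  rewrite [X in order_ge _ X](_ : _ =
    - (scomp (nonlinear_part (F i)) y - scomp (nonlinear_part (F i)) y')); last by ring.
  apply: order_geN.
  by apply: scomp_low_r => //;
    [exact: Sfix|exact: Sfix|exact: order_ge_nonlinear_part].
have G0 := Sfix _ GS; exists G; split=> // i Q; rewrite /smap_comp.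
rewrite scomp_nonlinear_part // F0 scale0r add0r; congr (_ Q).
under eq_bigr => j _ do rewrite GE scaler_sumr.
rewrite exchange_big /=.
under eq_bigr => k _ do (under eq_bigr => j _ do rewrite scalerA;
  rewrite -scaler_suml).
have ABE k : \sum_(j < n) F i U_(j)%MM * B j k = (i == k)%:R.
  move/matrixP/(_ i k): AB; rewrite !mxE => <-.
  by apply: eq_bigr => j _; rewrite mxE.
rewrite (bigD1 i) //= ABE eqxx scale1r big1 ?addr0 ?subrK // => k ki.
by rewrite ABE eq_sym (negPf ki) scale0r.
Qed.

Lemma smap_compA F G H : fixes_origin G -> fixes_origin H ->
  smap_comp (smap_comp F G) H = smap_comp F (smap_comp G H).
Proof. by move=> G0 H0; apply/funext => j; rewrite /smap_comp scompA. Qed.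

Lemma smap_comp_idr F : smap_comp F svar = F.
Proof. by apply/funext => j; rewrite /smap_comp scomp_id. Qed.

Lemma smap_comp_idl F : fixes_origin F -> smap_comp svar F = F.
Proof. by move=> F0; apply/funext => j; rewrite /smap_comp scomp_svar. Qed.

Lemma smap_eq F G : F =2 G -> F = G.
Proof. by move=> FG; apply/funext => j; apply/funext => Q. Qed.

End FormalInverse.

(** * Majorants and partial sums *)

Section Modulus.
Context {R : realType}.
Implicit Types x y : R[i].

Lemma cmodE x : (cmod x)%:C%C = `|x|. Proof. by []. Qed.
Lemma cmod_ge0 x : 0 <= cmod x.
Proof. by rewrite -ler0c cmodE. Qed.
Lemma cmod0 : cmod 0 = 0 :> R. Proof. exact: ComplexField.Normc.normc0. Qed.
Lemma cmod1 : cmod 1 = 1 :> R. Proof. exact: ComplexField.Normc.normc1. Qed.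
Lemma cmodM x y : cmod (x * y) = cmod x * cmod y.
Proof. exact: ComplexField.Normc.normcM. Qed.
Lemma cmodV x : cmod x^-1 = (cmod x)^-1.
Proof. exact: ComplexField.Normc.normcV. Qed.
Lemma cmodD x y : cmod (x + y) <= cmod x + cmod y.
Proof. by rewrite -lecR rmorphD /= !cmodE ler_normD. Qed.
Lemma cmodN x : cmod (- x) = cmod x.
Proof. by apply: (@complexI R); rewrite !cmodE normrN. Qed.
Lemma cmodB x y : cmod (x - y) <= cmod x + cmod y.
Proof. by rewrite -(cmodN y) cmodD. Qed.
Lemma cmod_eq0 x : (cmod x == 0) = (x == 0).
Proof. by rewrite -(inj_eq (@complexI R)) cmodE normr_eq0. Qed.
Lemma cmod_gt0 x : (0 < cmod x) = (x != 0).
Proof. by rewrite lt_neqAle cmod_ge0 andbT eq_sym cmod_eq0. Qed.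
Lemma cmod_sum I (r : seq I) (p : pred I) (a : I -> R[i]) :
  cmod (\sum_(i <- r | p i) a i) <= \sum_(i <- r | p i) cmod (a i).
Proof.
elim/big_rec2: _ => [|i y x _ le_xy]; first by rewrite cmod0.
by apply: le_trans (cmodD _ _) _; rewrite lerD2l.
Qed.

End Modulus.

Section Majorants.
Context {R : realType} {n : nat}.
Implicit Types (f g h : series R[i] n) (a b : series R n) (G : smap R[i] n).
Implicit Types (Q : 'X_{1..n}) (r s : R).

Definition mabs f : series R n := fun Q => cmod (f Q).

Definition dominated a b := forall Q, a Q <= b Q.
Definition nonneg a := forall Q, 0 <= a Q.

Lemma nonneg_mabs f : nonneg (mabs f). Proof. by move=> Q; apply: cmod_ge0. Qed.
Lemma nonneg1 : nonneg 1. Proof. by move=> Q; apply: ler0n. Qed.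
Lemma nonneg_sum I (r : seq I) (p : pred I) (X : I -> series R n) :
  (forall i, p i -> nonneg (X i)) -> nonneg (\sum_(i <- r | p i) X i).
Proof. by move=> X0 Q; rewrite ssumE; apply: sumr_ge0 => i /X0. Qed.
Lemma nonnegM a b : nonneg a -> nonneg b -> nonneg (a * b).
Proof.
move=> a0 b0 Q; rewrite (smulM _ _ (ltnSn _)); apply: sumr_ge0 => P _.
exact: mulr_ge0.
Qed.

Lemma dominated_trans b a c : dominated a b -> dominated b c -> dominated a c.
Proof. by move=> ab bc Q; apply: le_trans (ab Q) (bc Q). Qed.
Lemma dominatedM a a' b b' : nonneg a -> nonneg b ->
  dominated a a' -> dominated b b' -> dominated (a * b) (a' * b').
Proof.
move=> a0 b0 aa' bb' Q; rewrite !(smulM _ _ (ltnSn _)).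
by apply: ler_sum => P _; apply: ler_pM.
Qed.
Lemma dominatedD a a' b b' :
  dominated a a' -> dominated b b' -> dominated (a + b) (a' + b').
Proof. by move=> aa' bb' Q; apply: lerD. Qed.

Lemma mabsM f g : dominated (mabs (f * g)) (mabs f * mabs g).
Proof.
move=> Q; rewrite /mabs !(smulM _ _ (ltnSn _)).
apply: le_trans (cmod_sum _ _ _) _.
by apply: ler_sum => P _; rewrite cmodM.
Qed.
Lemma mabsD f g : dominated (mabs (f + g)) (mabs f + mabs g).
Proof. by move=> Q; apply: cmodD. Qed.
Lemma mabs1 : mabs 1 = 1.
Proof.
by apply/funext => Q; rewrite /mabs !sone_E; case: eqP; rewrite ?cmod0 ?cmod1.
Qed.
Lemma mabs_svar j : mabs (svar j) = svar j.
Proof.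
by apply/funext => Q; rewrite /mabs !svarE; case: eqP; rewrite ?cmod0 ?cmod1.
Qed.
Lemma mabsZ (c : R[i]) f : mabs (c *: f) = cmod c *: mabs f.
Proof. by apply/funext => Q; rewrite /mabs !sscaleE cmodM. Qed.

Lemma order_ge_mabs k f : order_ge k f -> order_ge k (mabs f).
Proof. by move=> fk Q ltQ; rewrite /mabs fk ?cmod0. Qed.

Lemma nonneg_smonom (F : smap R n) P :
  (forall j, nonneg (F j)) -> nonneg (smonom F P).
Proof.
move=> F0; elim/(@mnm_ind n): P => [|i P IHP].
  by rewrite smonom0; apply: nonneg1.
by rewrite smonomD smonomU; apply: nonnegM.
Qed.

Lemma mabs_smonom G P :
  dominated (mabs (smonom G P)) (smonom (fun j => mabs (G j)) P).
Proof.
elim/(@mnm_ind n): P => [|i P IHP]; first by rewrite !smonom0 mabs1.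
rewrite !smonomD !smonomU; apply: dominated_trans (mabsM _ _) _.
by apply: dominatedM => //; apply: nonneg_mabs.
Qed.

(** The terms of degree below k of the value at (r, .., r): for nonnegative a,
    convergence on the polydisc of radius r is a bound on these that is uniform
    in k. *)
Definition psum k r a := \sum_(Q : 'X_{1..n < k}) a Q * r ^+ mdeg Q.

Lemma psumD k r a b : psum k r (a + b) = psum k r a + psum k r b.
Proof.
by rewrite /psum -big_split; apply: eq_bigr => Q _; rewrite saddE mulrDl.
Qed.

Lemma psumZ k r (c : R) a : psum k r (c *: a) = c * psum k r a.
Proof.
by rewrite /psum mulr_sumr; apply: eq_bigr => Q _; rewrite sscaleE mulrA.
Qed.

Lemma psum_sum k r I (s : seq I) (p : pred I) (X : I -> series R n) :
  psum k r (\sum_(i <- s | p i) X i) = \sum_(i <- s | p i) psum k r (X i).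
Proof.
rewrite /psum exchange_big /=; apply: eq_bigr => Q _.
by rewrite ssumE mulr_suml.
Qed.

Lemma psum_ge0 k r a : 0 <= r -> nonneg a -> 0 <= psum k r a.
Proof.
by move=> r0 a0; apply: sumr_ge0 => Q _; rewrite mulr_ge0 ?exprn_ge0.
Qed.

Lemma le_psum k r a b : 0 <= r -> 
  (forall Q, (mdeg Q < k)%N -> a Q <= b Q) -> psum k r a <= psum k r b.
Proof.
move=> r0 ab; apply: ler_sum => Q _.
by rewrite ler_wpM2r ?exprn_ge0 ?ab ?bmdeg.
Qed.

Lemma le_psum_index k k' r a : (k <= k')%N -> 0 <= r -> nonneg a ->
  psum k r a <= psum k' r a.
Proof.
move=> kk' r0 a0.
rewrite /psum (sum_bmnm_sub (fun Q => a Q * r ^+ mdeg Q) kk') big_mkcond /=.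
by apply: ler_sum => Q _; case: ifP => // _; rewrite mulr_ge0 ?exprn_ge0.
Qed.

Lemma psum1 k r : psum k.+1 r 1 = 1.
Proof.
rewrite /psum (bigD1 bm0) //= sone_E eqxx mdeg0 mulr1 big1 ?addr0 // => Q.
rewrite -val_eqE /= sone_E => /negPf ->.
by rewrite mul0r.
Qed.

Lemma psum_svar k r j : 0 <= r -> psum k r (svar j) <= r.
Proof.
move=> r0; apply: le_trans (le_psum_index (leq_addl 2 k) r0 _) _.
  by move=> Q; apply: ler0n.
have lt1 : (mdeg U_(j)%MM < 2 + k)%N by rewrite mdeg1.
rewrite /psum (bigD1 (BMultinom lt1)) //= svarE eqxx mdeg1 mul1r big1 ?addr0 //.
by move=> Q; rewrite -val_eqE /= svarE => /negPf ->; rewrite mul0r.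
Qed.

(** A term of degree below k of a product whose second factor has order q only
    involves terms of degree below k - q of the first factor.  This gain of
    degrees is what allows induction on k. *)
Lemma psumM k p q r a b : 0 <= r -> nonneg a -> nonneg b ->
  order_ge p a -> order_ge q b ->
  psum k r (a * b) <= psum (k - q) r a * psum (k - p) r b.
Proof.
move=> r0 a0 b0 ap bq.
pose t (A B : 'X_{1..n < k}) := (a A * r ^+ mdeg A) * (b B * r ^+ mdeg B).
have t0 A B : 0 <= t A B by rewrite !mulr_ge0 ?exprn_ge0.
have -> : psum k r (a * b) =
    \sum_(P : 'X_{1..n < k, k} | (mdeg (P.1 + P.2)%MM < k)%N) t P.1 P.2.
  rewrite /psum.
  under eq_bigr => Q _ do rewrite (smulM2 _ _ (bmdeg Q)) mulr_suml.
  rewrite (exchange_big_dep xpredT) //= [RHS]big_mkcond.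
  apply: eq_bigr => -[A B] _ /=; case: ltnP => [ltAB|leAB].
    rewrite (big_pred1 (BMultinom ltAB)) //= /t mdegD exprD; ring.
  by rewrite big1 // => Q /eqP e; move: (bmdeg Q); rewrite e ltnNge leAB.
rewrite /psum (sum_bmnm_sub (fun Q => a Q * r ^+ mdeg Q) (leq_subr q k)).
rewrite (sum_bmnm_sub (fun Q => b Q * r ^+ mdeg Q) (leq_subr p k)).
rewrite big_distrlr pair_big_dep /= big_mkcond [leRHS]big_mkcond /=.
apply: ler_sum => -[A B] _ /=; case: ifP => [ltAB|_]; last first.
  by case: ifP => // _; apply: t0.
case: ifP => // /negbT; rewrite negb_and -!leqNgt => le; rewrite /t.
have [ltA|leA] := ltnP (mdeg A) p; first by rewrite ap // !mul0r.
have [ltB|leB] := ltnP (mdeg B) q; first by rewrite bq // mul0r mulr0.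
by move: ltAB le; rewrite mdegD => ltAB /orP[]; lia.
Qed.

Lemma psum_mul k r a b : 0 <= r -> nonneg a -> nonneg b ->
  psum k r (a * b) <= psum k r a * psum k r b.
Proof.
move=> r0 a0 b0.
by have := psumM k r0 a0 b0 (@order_ge0 _ _ a) (@order_ge0 _ _ b); rewrite !subn0.
Qed.

Lemma psum_smonom k r s (F : smap R n) P : 0 <= r ->
  (forall j, nonneg (F j)) -> (forall j, psum k r (F j) <= s) ->
  psum k r (smonom F P) <= s ^+ mdeg P.
Proof.
move=> r0 F0 Fs; elim/(@mnm_ind n): P => [|i P IHP].
  rewrite smonom0 mdeg0 expr0; case: k Fs => [|k] Fs; last by rewrite psum1.
  rewrite /psum big1 // => Q _; by case: Q.
rewrite smonomD smonomU mdegD mdeg1 exprD.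
apply: le_trans (psum_mul _ r0 (F0 i) (nonneg_smonom _ F0)) _.
by apply: ler_pM => //; apply: psum_ge0 => //; apply: nonneg_smonom.
Qed.

(** As f has order at least two, terms of degree k of f o G only involve terms
    of lower degree of G. *)
Lemma psum_comp k r s f G : 0 <= r -> fixes_origin G -> order_ge 2 f ->
  (forall j, psum k r (mabs (G j)) <= s) ->
  psum k.+1 r (mabs (scomp f G)) <= psum k.+1 s (mabs f).
Proof.
move=> r0 G0 f2 Gs; pose F j := mabs (G j).
have F0 j : nonneg (F j) by apply: nonneg_mabs.
have F1 : fixes_origin F by move=> j; rewrite /F /mabs G0 cmod0.
apply: (@le_trans _ _ (\sum_(P : 'X_{1..n < k.+1})
   cmod (f P) * psum k.+1 r (smonom F P))).
  rewrite /psum; under [leRHS]eq_bigr => P _ do rewrite mulr_sumr.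
  rewrite [leRHS]exchange_big /=; apply: ler_sum => Q _.
  rewrite /mabs (scompE _ G0 (bmdeg Q)).
  apply: le_trans (ler_wpM2r (exprn_ge0 _ r0) (cmod_sum _ _ _)) _.
  rewrite mulr_suml; apply: ler_sum => P _; rewrite cmodM -mulrA.
  rewrite ler_wpM2l ?cmod_ge0 // ler_wpM2r ?exprn_ge0 //.
  exact: (mabs_smonom G P Q).
apply: ler_sum => P _; have [ltP|leP] := ltnP (mdeg P) 2.
  by rewrite /mabs f2 // cmod0 !mul0r.
rewrite ler_wpM2l ?cmod_ge0 //.
have [j Pj] := mdeg_gt0P (ltnW leP).
have leU : (U_(j) <= P)%MM.
  apply/mnm_lepP => i; rewrite mnm1E; case: eqP => // <-; lia.
rewrite -(submK leU); set P' := (P - U_(j))%MM.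
have P'1 : (1 <= mdeg P')%N.
  by move: leP; rewrite -(submK leU) -/P' mdegD mdeg1; lia.
rewrite smonomD smonomU mdegD mdeg1 exprD expr1.
have := @psumM k.+1 1 1 r _ _ r0 (nonneg_smonom P' F0) (F0 j)
  (order_geW P'1 (order_ge_smonom (P := P') F1)) ((fixes_originP F).1 F1 j).
rewrite subSS subn0 => /le_trans; apply.
apply: ler_pM; rewrite ?psum_ge0 //; first exact: nonneg_smonom.
  exact: psum_smonom.
exact: Gs.
Qed.

Lemma psum_order2 k s s0 a : 0 <= s -> s <= s0 -> 0 < s0 -> nonneg a ->
  order_ge 2 a -> psum k s a <= (s / s0) ^+ 2 * psum k s0 a.
Proof.
move=> s_ge0 ss0 s0_gt0 a0 a2; rewrite /psum mulr_sumr.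
apply: ler_sum => Q _; have [ltQ|leQ] := ltnP (mdeg Q) 2.
  by rewrite a2 // !mul0r mulr0.
rewrite mulrCA ler_wpM2l // -(subnKC leQ) !exprD mulrA -exprMn.
rewrite divfK ?gt_eqF // ler_wpM2l ?exprn_ge0 //.
by rewrite lerXn2r ?nnegrE ?(le_trans s_ge0).
Qed.

Lemma dominated_convergent f g : dominated (mabs f) (mabs g) ->
  convergent g -> convergent f.
Proof.
move=> fg [r [M [r0 gM]]]; exists r, M; split=> // k.
apply: le_trans (gM k); apply: (@le_psum k r (mabs f) (mabs g) (ltW r0)) => Q _.
exact: fg.
Qed.

Lemma nonlinear_part_coef f Q :
  nonlinear_part f Q = if (mdeg Q < 2)%N then 0 else f Q.
Proof.
case: ifP => [/order_ge_nonlinear_part //|/negbT]; rewrite -leqNgt => leQ.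
rewrite /nonlinear_part !saddE !soppE ssumE sscaleE sone_E -mdeg_eq0.
rewrite [_ == _](_ : _ = false) ?mulr0 ?subr0; last by lia.
rewrite big1 ?subr0 // => i _; rewrite sscaleE svarE.
case: eqP => [QU|]; last by rewrite mulr0.
by move: leQ; rewrite QU mdeg1.
Qed.

Lemma convergent_nonlinear_part f : convergent f -> convergent (nonlinear_part f).
Proof.
apply: dominated_convergent => Q; rewrite /mabs nonlinear_part_coef.
case: ifP => // _.
by rewrite cmod0 cmod_ge0.
Qed.

End Majorants.

(** * Inverse maps and their linear parts *)

Section MoreInverse.
Context {K : comUnitRingType} {n : nat}.
Implicit Types (F G : smap K n).

Lemma linear_part_comp F G : fixes_origin G ->
  linear_part (smap_comp F G) = linear_part F *m linear_part G.
Proof.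
move=> G0; apply/matrixP => i j; rewrite !mxE /smap_comp scomp_linear //.
by apply: eq_bigr => k _; rewrite !mxE.
Qed.

Lemma linear_part_id : linear_part (@svar K n) = 1%:M.
Proof.
apply/matrixP => i j; rewrite !mxE svarE eq_sym.
congr (_%:R); congr nat_of_bool; apply/eqP/eqP => [|->//].
move=> /(congr1 (fun m : 'X_{1..n} => m i)); rewrite !mnm1E eqxx.
by case: eqP.
Qed.

Lemma inverse_linear_part F G : fixes_origin F -> fixes_origin G ->
  smap_comp F G =2 svar -> linear_part F *m linear_part G = 1%:M.
Proof.
by move=> F0 G0 /smap_eq FG; rewrite -linear_part_comp // FG linear_part_id.
Qed.

(** The right inverse G of F has a right inverse in its turn, and the latter
    must be F. *)
Lemma right_inverse_is_inverse F G : fixes_origin F -> fixes_origin G ->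
  smap_comp F G =2 svar -> smap_comp G F =2 svar.
Proof.
move=> F0 G0 FG; have /mulmx1C GF := inverse_linear_part F0 G0 FG.
have [||H [_ H0 /smap_eq GH]] :=
    @formal_right_inverse K n (fun _ Q => Q <> 0%MM) G _ G0 GF.
- by move=> _; apply.
- move=> H HS j Q; apply: contra_neq_not => ->.
  have H0 : fixes_origin H by move=> i; apply/eqP; apply: contraTT isT => /HS.
  rewrite ssumE big1 // => i _; rewrite sscaleE saddE soppE scomp0.
  by rewrite order_ge_nonlinear_part ?mdeg0 // svarE eq_sym mnm1_eq0 subrr mulr0.
suff -> : F = H by rewrite GH.
rewrite -[LHS]smap_comp_idr -GH -smap_compA // (smap_eq FG).
by rewrite smap_comp_idl.
Qed.

End MoreInverse.

(** * Resonances *)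

Section Characters.
Context {R : realType} {n l : nat} (mu : 'M[R[i]]_(l, n)).
Local Notation C := R[i].
Implicit Types (f g h : series C n) (Q : 'X_{1..n}) (G H : smap C n).
Implicit Types (lam : 'I_l -> C).

Lemma eigmonom0 m : eigmonom mu m 0%MM = 1.
Proof. by rewrite /eigmonom big1 // => j _; rewrite mnm0E. Qed.

Lemma eigmonomD m P Q :
  eigmonom mu m (P + Q)%MM = eigmonom mu m P * eigmonom mu m Q.
Proof.
by rewrite -big_split; apply: eq_bigr => j _; rewrite mnmDE exprD.
Qed.

Lemma eigmonomU m j : eigmonom mu m U_(j)%MM = mu m j.
Proof.
rewrite /eigmonom (bigD1 j) //= big1 ?mulr1 => [|i ij]; rewrite mnm1E.
  by rewrite eqxx.
by rewrite eq_sym (negPf ij).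
Qed.

(** The eigenvector equation f o D_m = lam_m f for all m, expressed on supports:
    a monomial z^Q has the character (mu_m^Q)_m. *)
Definition has_char lam f :=
  supported (fun Q => forall m, eigmonom mu m Q = lam m) f.

Definition resonant j Q := forall m, eigmonom mu m Q = mu m j.

Definition invariant_series f := has_char (fun=> 1) f.

Lemma supported_mul_neq0 f g Q : (f * g) Q != 0 ->
  exists A B, [/\ Q = (A + B)%MM, f A != 0 & g B != 0].
Proof.
rewrite (smulM _ _ (ltnSn _)) => fgQ.
have [A /andP[leA]] : exists A : 'X_{1..n < (mdeg Q).+1},
    (A <= Q)%MM && (f A * g (Q - A)%MM != 0).
  apply/existsP; apply: contra_neqT fgQ; rewrite negb_exists => /forallP fg0.
  by apply: big1 => A leA; have := fg0 A; rewrite leA /= negbK => /eqP.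
rewrite mulf_eq0 negb_or => /andP[fA gB].
by exists A, (Q - A)%MM; split=> //; rewrite addmC submK.
Qed.

Lemma has_charM lam lam' f g : has_char lam f -> has_char lam' g ->
  has_char (fun m => lam m * lam' m) (f * g).
Proof.
move=> fl gl Q /supported_mul_neq0[A [B [-> fA gB]]] m.
by rewrite eigmonomD (fl _ fA) (gl _ gB).
Qed.

Lemma invariantM f g :
  invariant_series f -> invariant_series g -> invariant_series (f * g).
Proof.
by move=> fl gl Q fgQ m; rewrite (has_charM fl gl fgQ) mulr1.
Qed.

Lemma has_charD lam f g : has_char lam f -> has_char lam g ->
  has_char lam (f + g).
Proof.
move=> fl gl Q; have [fQ|fQ _] := eqVneq (f Q) 0; last exact: fl.
by rewrite saddE fQ add0r; apply: gl.
Qed.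

Lemma has_charZ lam (c : C) f : has_char lam f -> has_char lam (c *: f).
Proof.
by move=> fl Q; rewrite sscaleE mulf_eq0 negb_or => /andP[_]; apply: fl.
Qed.

Lemma has_char_sum lam I (r : seq I) (p : pred I) (X : I -> series C n) :
  (forall i, p i -> has_char lam (X i)) ->
  has_char lam (\sum_(i <- r | p i) X i).
Proof.
move=> Xl; apply: big_ind => //; last exact: has_charD.
by move=> Q; rewrite szeroE eqxx.
Qed.

Lemma invariant1 : invariant_series 1.
Proof.
move=> Q; rewrite sone_E; have [->|_] := eqVneq Q 0%MM; last by rewrite eqxx.
by move=> _ m; rewrite eigmonom0.
Qed.

Lemma has_char_svar j : has_char (mu^~ j) (svar j).
Proof.
move=> Q; rewrite svarE; have [->|_] := eqVneq Q U_(j)%MM; last by rewrite eqxx.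
by move=> _ m; rewrite eigmonomU.
Qed.

Lemma has_char_nonlinear_part lam f :
  has_char lam f -> has_char lam (nonlinear_part f).
Proof.
move=> fl Q; rewrite nonlinear_part_coef.
by case: ifP => _; [rewrite eqxx|apply: fl].
Qed.

Lemma has_char_smonom G P : (forall j, has_char (mu^~ j) (G j)) ->
  has_char (eigmonom mu ^~ P) (smonom G P).
Proof.
move=> Gl; elim/(@mnm_ind n): P => [|j P IHP].
  by rewrite smonom0 => Q /invariant1 Q1 m; rewrite Q1 eigmonom0.
rewrite smonomD smonomU => Q /(has_charM (Gl j) IHP) Ql m.
by rewrite Ql eigmonomD eigmonomU.
Qed.

Lemma invariant_smonom G P : (forall j, invariant_series (G j)) ->
  invariant_series (smonom G P).
Proof.
move=> Gl; elim/(@mnm_ind n): P => [|j P IHP].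
  by rewrite smonom0; apply: invariant1.
by rewrite smonomD smonomU; apply: invariantM.
Qed.

(** A map with components of characters mu_j commutes with every D_m. *)
Lemma has_char_scomp lam f G : (forall j, has_char (mu^~ j) (G j)) ->
  has_char lam f -> has_char lam (scomp f G).
Proof.
move=> Gl fl Q; rewrite /scomp; apply: contra_neqP => QNlam.
apply: big1 => P _; have [->|fP] := eqVneq (f P) 0; first by rewrite mul0r.
have [->|GP] := eqVneq (smonom G P Q) 0; first by rewrite mulr0.
by case: QNlam => m; rewrite (has_char_smonom Gl GP) (fl _ fP).
Qed.

Lemma invariant_inverse f : invariant_series f -> f 0%MM != 0 ->
  exists g, [/\ invariant_series g, g * f = 1 & g 0%MM = (f 0%MM)^-1].
Proof.
move=> fi f0; pose h := 1 - (f 0%MM)^-1 *: f.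
have h1 : order_ge 1 h.
  move=> Q; rewrite ltnS leqn0 mdeg_eq0 => /eqP ->.
  by rewrite /h saddE soppE sscaleE sone_E eqxx mulVf // subrr.
have hi : invariant_series h.
  apply: has_charD; first exact: invariant1.
  by rewrite -scaleNr; apply: has_charZ.
have [y [yi yE]] : exists y, invariant_series y /\ y = 1 + h * y.
  apply: geometric_series => // y yi; apply: has_charD; first exact: invariant1.
  exact: invariantM.
have yf : y * ((f 0%MM)^-1 *: f) = 1.
  have -> : (f 0%MM)^-1 *: f = 1 - h by rewrite /h opprB addrC subrK.
  by rewrite mulrBr mulr1 [y * h]mulrC {1}yE addrK.
exists ((f 0%MM)^-1 *: y); split; first exact: has_charZ.
  by rewrite -sscaleAl sscaleAr.
rewrite sscaleE yE saddE sone_E eqxx -[(h * y) _]/((h * y) 0%MM).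
by rewrite (order_geM h1 (@order_ge0 _ _ y)) ?mdeg0 // addr0 mulr1.
Qed.

End Characters.

(** * Normalizing transformations without resonant terms *)

Section Normalization.
Context {R : realType} {n l : nat} (mu : 'M[R[i]]_(l, n)).
Context (F : 'I_l -> smap R[i] n).
Local Notation C := R[i].
Implicit Types (Q : 'X_{1..n}).

(** Complete integrability over the ring of series.  Commutation of nu with the
    D_m is a condition on supports, and the last clause also covers the linear
    resonances, where |Q| = 1. *)
Definition normalizes (Phi Psi : smap C n) (nu : 'I_l -> smap C n) : Prop :=
  [/\ [/\ fixes_origin Phi, fixes_origin Psi & inverse_smaps Phi Psi],
      forall m j, smap_comp Psi (smap_comp (F m) Phi) j = nu m j * svar j,
      forall m j, nu m j 0%MM = mu m j,
      forall m j, invariant_series mu (nu m j)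
    & forall j Q, (0 < mdeg Q)%N -> resonant mu j Q ->
        forall m, smonom (nu m) Q = nu m j].

Hypothesis F_linear : forall m, linear_part (F m) = diag_mx (row m mu).
Hypothesis mu_neq0 : forall m j, mu m j != 0.
Hypothesis F0 : forall m, fixes_origin (F m).

Lemma linear_partE m i j : F m i U_(j)%MM = mu m i *+ (i == j).
Proof.
by have /matrixP/(_ i j) := F_linear m; rewrite !mxE.
Qed.

Lemma linear_smap_diagE m : linear_smap (linear_part (F m)) =
  (fun i => mu m i *: svar i) :> smap C n.
Proof.
apply/funext => i; apply/funext => Q; rewrite /linear_smap.
rewrite (bigD1 i) //= F_linear !mxE eqxx mulr1n big1 ?addr0 // => j ji.
by rewrite !mxE eq_sym (negPf ji) mul0r.
Qed.

Lemma prod_exprUD (c : 'I_n -> C) i (P : 'X_{1..n}) :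
  \prod_j c j ^+ (U_(i) + P)%MM j = c i * \prod_j c j ^+ P j.
Proof.
under eq_bigr => j _ do rewrite mnmDE exprD mnm1E.
rewrite big_split /= (bigD1 i) //= eqxx big1 ?mulr1 // => j ji.
by rewrite eq_sym (negPf ji).
Qed.

Lemma smonom_scale (c : 'I_n -> C) (G : smap C n) P :
  smonom (fun i => c i *: G i) P = (\prod_i c i ^+ P i) *: smonom G P.
Proof.
elim/(@mnm_ind n): P => [|i P IHP].
  by rewrite !smonom0 big1 ?scale1r // => i _; rewrite mnm0E.
rewrite !smonomD !smonomU IHP -sscaleAl -sscaleAr scalerA.
by rewrite prod_exprUD.
Qed.

Lemma scomp_linear_diag m f Q :
  scomp f (linear_smap (linear_part (F m))) Q = f Q * eigmonom mu m Q.
Proof.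
rewrite linear_smap_diagE /scomp.
rewrite (bigD1 (BMultinom (ltnSn (mdeg Q)))) //= smonom_scale smonom_svar.
rewrite sscaleE /smon eqxx mulr1 [X in _ + X]big1 ?addr0 // => P.
rewrite -val_eqE /= => /negPf PQ.
by rewrite smonom_scale smonom_svar sscaleE /smon eq_sym PQ !mulr0.
Qed.

Lemma smul_at0 (f g : series C n) : (f * g) 0%MM = f 0%MM * g 0%MM.
Proof.
rewrite (smulM (k := 1)) ?mdeg0 // (bigD1 bm0) ?lepm_refl //= subm0.
rewrite big1 ?addr0 // => A /andP[_]; rewrite -val_eqE /= -mdeg_eq0.
by rewrite -leqn0 -ltnS bmdeg.
Qed.

Lemma smonom_at0 (G : smap C n) P :
  smonom G P 0%MM = \prod_i G i 0%MM ^+ P i.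
Proof.
elim/(@mnm_ind n): P => [|i P IHP].
  by rewrite smonom0 sone_E eqxx big1 // => i _; rewrite mnm0E.
by rewrite smonomD smonomU smul_at0 IHP prod_exprUD.
Qed.

Lemma normalizes_integrable (reg : series C n -> Prop) Phi Psi nu :
  normalizes Phi Psi nu ->
  (forall j, reg (Phi j) /\ reg (Psi j)) -> (forall m j, reg (nu m j)) ->
  integrable_in reg F.
Proof.
move=> [[Phi0 Psi0 PhiPsi] conj nu0 nui nures] Phireg nureg.
exists Phi, Psi, nu; split=> [|m j|m j Q|m m' j Q|j Q ltQ]; first by split.
- by split=> //; rewrite nu0 !mxE linear_partE eqxx.
- by rewrite conj.
- rewrite scomp_linear_diag; have [->|nuQ] := eqVneq (nu m j Q) 0.
    by rewrite mul0r.
  by rewrite (nui _ _ _ nuQ) mulr1.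
split=> [eqQ m Q'|eqQ m].
  rewrite (nures j) //; first exact: ltnW.
  move=> m'; rewrite -nu0 -eqQ; apply: eq_bigr => i _.
  by rewrite nu0.
have := eqQ m 0%MM; rewrite nu0 => <-.
by rewrite -smonom_at0.
Qed.

(** A linear resonance mu_mk = mu_mj, all m, forces nu_mk = nu_mj: if some
    invariant P <> 0 exists, then (k, U_k + P) and (j, U_k + P) are resonant of
    degree above one; otherwise the nu_mj are constants. *)
Lemma integrable_normalizes (reg : series C n -> Prop) :
  integrable_in reg F -> exists Phi Psi nu, normalizes Phi Psi nu.
Proof.
move=> [Phi [Psi [nu [[Phi0 Psi0 PhiPsi _] nu0' conj nui' nures']]]].
have nu0 m j : nu m j 0%MM = mu m j.
  by rewrite (nu0' m j).2 !mxE linear_partE eqxx.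
have nui m j : invariant_series mu (nu m j).
  move=> Q nuQ m'; apply: (mulfI nuQ); rewrite mulr1 -scomp_linear_diag.
  exact: nui'.
have nures j Q : (1 < mdeg Q)%N -> resonant mu j Q ->
    forall m, smonom (nu m) Q = nu m j.
  move=> ltQ resQ m; apply/funext; apply: (nures' j Q ltQ).1 => m'.
  by rewrite nu0 -resQ; apply: eq_bigr => i _; rewrite nu0.
exists Phi, Psi, nu; split=> // [m j|j Q Q0 resQ m].
  by apply/funext => Q; apply: conj.
have [Q1|] := leqP (mdeg Q) 1; last by move/nures; apply.
have /mdeg1P[k /eqP QU] : mdeg Q == 1%N by rewrite eqn_leq Q1.
rewrite {}QU in resQ *; rewrite smonomU => {Q1 Q0 Q}.
have [[P [P0 invP]]|noinv] := pselect
    (exists P : 'X_{1..n}, (0 < mdeg P)%N /\ forall m, eigmonom mu m P = 1).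
  have res i : resonant mu i U_(k)%MM -> smonom (nu m) (U_(k) + P)%MM = nu m i.
    move=> resi; apply: nures; first by rewrite mdegD mdeg1; lia.
    by move=> m'; rewrite eigmonomD invP mulr1.
  by rewrite -(res j) // -(res k) // => m'; rewrite eigmonomU.
have nuC i : nu m i = mu m i *: (1 : series C n).
  apply/funext => Q; rewrite sscaleE sone_E.
  have [->|Q0] := eqVneq Q 0%MM; first by rewrite nu0 mulr1.
  rewrite mulr0; apply/eqP; apply: contraT => nuQ; case: noinv; exists Q.
  by split; [rewrite lt0n mdeg_eq0|apply: nui nuQ].
by rewrite !nuC -resQ eigmonomU.
Qed.

Section Consequences.
Context (Phi Psi : smap C n) (nu : 'I_l -> smap C n).
Hypothesis norm : normalizes Phi Psi nu.

(** For P <> 0 and any j the exponent U_j + P is resonant, so nu_j nu^P = nu_j,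
    and nu_j is a unit. *)
Lemma smonom_invariant P : (forall m, eigmonom mu m P = 1) ->
  forall m, smonom (nu m) P = 1.
Proof.
case: norm => _ _ nu0 nui nures invP m.
have [P0|] := posnP (mdeg P).
  by move/eqP: P0; rewrite mdeg_eq0 => /eqP ->; rewrite smonom0.
move=> /mdeg_gt0P[j _].
have [y [_ yE _]] : exists y,
    [/\ invariant_series mu y, y * nu m j = 1 & y 0%MM = (nu m j 0%MM)^-1].
  by apply: invariant_inverse; rewrite ?nu0.
have resP : resonant mu j (U_(j) + P).
  by move=> m'; rewrite eigmonomD invP mulr1 eigmonomU.
have degP : (0 < mdeg (U_(j) + P)%MM)%N by rewrite mdegD mdeg1.
have := nures _ _ degP resP m.
rewrite smonomD smonomU => /(congr1 ( *%R y)).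
by rewrite mulrA yE mul1r.
Qed.

Definition normal_form m : smap C n := fun j => nu m j * svar j.

Lemma fixes_origin_normal_form m : fixes_origin (normal_form m).
Proof.
apply/fixes_originP => j; apply: order_geMl => Q.
rewrite ltnS leqn0 mdeg_eq0 => /eqP ->.
by rewrite svarE eq_sym mnm1_eq0.
Qed.

Lemma smonom_normal_form m P :
  smonom (normal_form m) P = smonom (nu m) P * smon P.
Proof.
elim/(@mnm_ind n): P => [|j P IHP]; first by rewrite !smonom0 mulr1.
by rewrite !smonomD !smonomU IHP smonD smonU mulrACA.
Qed.

Lemma conjugacy m : smap_comp (F m) Phi = smap_comp Phi (normal_form m).
Proof.
case: norm => -[Phi0 Psi0 [/smap_eq PhiPsi _]] conj _ _ _.
have -> : normal_form m = smap_comp Psi (smap_comp (F m) Phi).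
  by apply/funext => j; rewrite conj.
have FPhi0 := fixes_origin_comp Phi (F0 m).
by rewrite -smap_compA // PhiPsi smap_comp_idl.
Qed.

Lemma smonom_comparable P Q :
  (forall m, eigmonom mu m P = eigmonom mu m Q) ->
  (P <= Q)%MM \/ (Q <= P)%MM ->
  forall m, smonom (nu m) P = smonom (nu m) Q.
Proof.
wlog lePQ : P Q / (P <= Q)%MM => [wlg eqPQ cmpPQ m|eqPQ _ m].
  by case: cmpPQ => le; [apply: wlg|apply/esym/wlg] => //; left.
rewrite -{1}(submK lePQ) smonomD (@smonom_invariant (Q - P)%MM) ?mul1r // => m'.
have eigP : eigmonom mu m' P != 0.
  by apply/prodf_neq0 => j _; rewrite expf_neq0.
by apply: (mulIf eigP); rewrite -eigmonomD submK // mul1r.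
Qed.

(** Only the P with Q - P invariant contribute, and for these the factors
    nu^P and nu^Q coincide. *)
Lemma scomp_normal_form f m Q :
  scomp f (normal_form m) Q = (smonom (nu m) Q * f) Q.
Proof.
rewrite mulrC (smulM _ _ (ltnSn _)) /scomp [RHS]big_mkcond /=.
apply: eq_bigr => -[P /= _] _; rewrite smonom_normal_form.
case: ifP => [lePQ|/negbT nPQ]; last by rewrite smul_smon0 ?mulr0.
rewrite -{1}(submK lePQ) smul_smon; congr (_ * _).
case: (norm) => _ _ _ nui _.
have nuA A : smonom (nu m) A (Q - P)%MM != 0 ->
    forall m', eigmonom mu m' (Q - P)%MM = 1.
  by move=> nuAQ m'; rewrite (invariant_smonom (nui m) nuAQ).
have nuQ : (forall m', eigmonom mu m' (Q - P)%MM = 1) ->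
    smonom (nu m) Q = smonom (nu m) P.
  by move=> inv; rewrite -{1}(submK lePQ) smonomD (smonom_invariant inv) mul1r.
have [nuP0|/nuA/nuQ -> //] := eqVneq (smonom (nu m) P (Q - P)%MM) 0.
have [nuQ0|/nuA/nuQ -> //] := eqVneq (smonom (nu m) Q (Q - P)%MM) 0.
by rewrite nuP0 nuQ0.
Qed.

(** F_m o Phi = Phi o F^_m, read off at the monomial z^Q. *)
Lemma conjugacy_coef m j Q :
  (smonom (nu m) Q * Phi j) Q =
  mu m j * Phi j Q + scomp (nonlinear_part (F m j)) Phi Q.
Proof.
case: (norm) => -[Phi0 _ _] _ _ _ _.
rewrite -scomp_normal_form.
have -> : scomp (Phi j) (normal_form m) = scomp (F m j) Phi.
  by have := congr1 (fun G => G j) (conjugacy m).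
rewrite scomp_nonlinear_part // F0 scale0r add0r saddE; congr (_ + _).
rewrite ssumE (bigD1 j) //= sscaleE linear_partE eqxx big1 ?addr0 // => k kj.
by rewrite sscaleE linear_partE eq_sym (negPf kj) mul0r.
Qed.

End Consequences.

(** The resonant part chi of Phi contains its linear part, since the linear part
    commutes with all D_m; hence chi is invertible, its inverse kappa is again
    resonant, and Phi o kappa = z + (Phi - chi) o kappa has no further resonant
    term. *)
Lemma nonresonant_normalization Phi Psi nu : normalizes Phi Psi nu ->
  exists Phi1 Psi1 nu1, normalizes Phi1 Psi1 nu1 /\
    forall j Q, resonant mu j Q -> Phi1 j Q = svar j Q.
Proof.
move=> norm; have [[Phi0 Psi0 PhiPsi] conj nu0 nui nures] := norm.
pose chi : smap C n := fun j Q => if `[< resonant mu j Q >] then Phi j Q else 0.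
have chi0 : fixes_origin chi by move=> j; rewrite /chi Phi0 if_same.
have chi_char j : has_char mu (mu^~ j) (chi j).
  by move=> Q; rewrite /chi; case: asboolP => // _; rewrite eqxx.
set A := linear_part Phi; set B := linear_part Psi.
have AB : A *m B = 1%:M by apply: inverse_linear_part => //; case: PhiPsi.
have Dlin m : linear_part (normal_form nu m) = diag_mx (row m mu).
  apply/matrixP => i j; rewrite !mxE /normal_form.
  have [<-|ij] := eqVneq i j.
    by rewrite mulr1n -smonU -{2}[U_(i)%MM]add0m smul_smon nu0.
  rewrite mulr0n -smonU smul_smon0 //; apply: contra ij => /mnm_lepP/(_ i).
  by rewrite !mnm1E eqxx eq_sym; case: eqP.
have AD m : diag_mx (row m mu) *m A = A *m diag_mx (row m mu).
  rewrite -[in LHS]F_linear -linear_part_comp // (conjugacy norm).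
  rewrite linear_part_comp ?Dlin //; exact: fixes_origin_normal_form.
have BD m : diag_mx (row m mu) *m B = B *m diag_mx (row m mu).
  have BA := mulmx1C AB.
  rewrite -[LHS]mul1mx -BA -!mulmxA; congr (_ *m _).
  by rewrite mulmxA -AD -mulmxA AB mulmx1.
have comm (M : 'M[C]_n) i j :
    (forall m, diag_mx (row m mu) *m M = M *m diag_mx (row m mu)) ->
    M i j != 0 -> forall m, mu m i = mu m j.
  move=> MD Mij m; apply: (mulIf Mij).
  have /matrixP/(_ i j) := MD m.
  by rewrite mul_diag_mx mul_mx_diag !mxE => ->; rewrite mulrC.
have chiA : linear_part chi = A.
  apply/matrixP => i j; rewrite !mxE /chi; case: asboolP => // nres.
  apply/esym/eqP; apply: contra_notT nres => Aij m.
  by rewrite eigmonomU -(comm A i j) // mxE.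
have [|||kappa [kappaS kappa0 chikappa]] := @formal_right_inverse C n
    (fun j Q => Q <> 0%MM /\ resonant mu j Q) chi B chi0.
- by rewrite chiA.
- by move=> j [].
- move=> G GS j.
  have GC i : has_char mu (mu^~ i) (G i) by move=> Q /GS[].
  have G0 : fixes_origin G.
    by move=> i; apply/eqP; apply: contraT => /GS[].
  move=> Q BQ; split.
    move=> Q0; move: BQ; rewrite Q0 ssumE big1 ?eqxx // => i _.
    rewrite sscaleE saddE soppE scomp0 order_ge_nonlinear_part ?mdeg0 //.
    by rewrite svarE eq_sym mnm1_eq0 subrr mulr0.
  move: Q BQ; apply: has_char_sum => i _.
  have [->|Bji] := eqVneq (B j i) 0.
    by move=> Q; rewrite scale0r szeroE eqxx.
  have eqij : forall m, mu m j = mu m i by apply: comm Bji.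
  apply: has_charZ => Q Qi m; rewrite eqij; move: Q Qi m.
  apply: has_charD; first exact: has_char_svar.
  rewrite -scaleN1r; apply: has_charZ; apply: has_char_scomp => //.
  exact: has_char_nonlinear_part.
have kappaC j : has_char mu (mu^~ j) (kappa j) by move=> Q /kappaS[].
have kappachi := right_inverse_is_inverse chi0 kappa0 chikappa.
have [/smap_eq PP /smap_eq PP'] := PhiPsi.
move/smap_eq in chikappa; move/smap_eq in kappachi.
pose nu1 m j := scomp (nu m j) kappa.
exists (smap_comp Phi kappa), (smap_comp chi Psi), nu1; split; first split.
- split; [exact: fixes_origin_comp..|split].
    rewrite smap_compA //; last exact: fixes_origin_comp.
    by rewrite -[smap_comp kappa _]smap_compA // kappachi smap_comp_idl // PP.
  rewrite smap_compA //; last exact: fixes_origin_comp.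
  by rewrite -[smap_comp Psi _]smap_compA // PP' smap_comp_idl // chikappa.
- move=> m j.
  have conjE : smap_comp Psi (smap_comp (F m) Phi) = normal_form nu m.
    by apply/funext => i; rewrite conj.
  have FPhi0 := fixes_origin_comp Phi (F0 m).
  have -> : smap_comp (smap_comp chi Psi)
        (smap_comp (F m) (smap_comp Phi kappa)) =
      smap_comp (smap_comp chi (normal_form nu m)) kappa.
    rewrite -(smap_compA (F m)) // -(smap_compA (smap_comp chi Psi)) //.
    by rewrite (smap_compA chi) // conjE.
  rewrite /smap_comp (@scomp_factor _ _ (chi j) (nu m j) (normal_form nu m) svar).
  + rewrite scomp_id scompM // -[scomp (chi j) kappa]/(smap_comp chi kappa j).
    by rewrite chikappa.
  + exact: fixes_origin_normal_form.
  + by move=> i; rewrite svarE eq_sym mnm1_eq0.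
  + move=> P chiP; rewrite smonom_normal_form smonom_svar (nures j) //.
      rewrite lt0n mdeg_eq0; apply: contraNneq chiP => ->.
      by rewrite chi0.
    by move=> m'; apply: chi_char chiP m'.
- by move=> m j; rewrite /nu1 scomp0 nu0.
- by move=> m j; apply: (has_char_scomp kappaC (nui m j)).
- by move=> j Q Q0 resQ m; rewrite /nu1 -(nures j Q Q0 resQ m) scomp_smonom.
move=> j Q resQ; rewrite /smap_comp.
have -> : Phi j = chi j + (Phi j - chi j) by rewrite addrC subrK.
rewrite scompD -[scomp (chi j) kappa]/(smap_comp chi kappa j) chikappa saddE.
rewrite [X in _ + X]big1 ?addr0 // => P _; apply/eqP; apply: contraT.
rewrite mulf_eq0 negb_or => /andP[PhiP kappaP].
move: PhiP; rewrite saddE soppE /chi; case: asboolP; rewrite ?subrr ?eqxx //.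
by case=> m; rewrite -resQ (has_char_smonom kappaC kappaP).
Qed.

End Normalization.

(** * A majorant for powers of near-unit series *)

Section GeometricMajorant.
Context {R : realType} {n : nat}.
Implicit Types (rho tau : series R n) (V W w : series R[i] n).
Context (d : R) (rho tau : series R n).
Hypotheses (d_gt1 : 1 < d) (rho_ge0 : nonneg rho) (rho1 : order_ge 1 rho).
Local Notation t := (1 - d^-1).
Hypotheses (tau_ge0 : nonneg tau) (tauE : rho * tau = t *: (tau - 1)).

Let d_gt0 : 0 < d. Proof. exact: lt_trans d_gt1. Qed.

Let t_gt0 : 0 < t.
Proof. by rewrite subr_gt0 invf_lt1 // (lt_trans ltr01). Qed.

Lemma dominated1_tau : dominated 1 tau.
Proof.
have : nonneg (t *: (tau - 1)) by rewrite -tauE; apply: nonnegM.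
move=> tau1 Q; have := tau1 Q; rewrite sscaleE saddE soppE.
by rewrite pmulr_rge0 // subr_ge0.
Qed.

(** tau (1 + rho) << (2 - 1/d) tau, and 2 - 1/d <= d. *)
Lemma dominated_mul_near1 (K : R) W w : 0 <= K ->
  dominated (mabs W) (K *: tau) -> dominated (mabs (w - 1)) rho ->
  dominated (mabs (W * w)) ((K * d) *: tau).
Proof.
move=> K0 Wtau wrho.
have wrho1 : dominated (mabs w) (1 + rho).
  have {1}-> : w = 1 + (w - 1) by rewrite addrC subrK.
  apply: dominated_trans (mabsD _ _) _; rewrite mabs1.
  by apply: dominatedD.
apply: dominated_trans (mabsM _ _) _.
apply: dominated_trans (dominatedM (nonneg_mabs _) (nonneg_mabs _) Wtau wrho1) _.
rewrite mulrDr mulr1 -sscaleAl [tau * rho]mulrC tauE => Q.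
rewrite saddE !sscaleE saddE soppE -mulrA -mulrDr ler_wpM2l //.
have tau0 := tau_ge0 Q; have one0 : 0 <= (1 : series R n) Q := nonneg1 Q.
apply: (@le_trans _ _ ((1 + t) * tau Q)).
  by have := mulr_ge0 (ltW t_gt0) one0; lra.
rewrite ler_wpM2r // -subr_ge0.
have -> : d - (1 + t) = (d - 1) ^+ 2 / d by field; rewrite gt_eqF.
by rewrite divr_ge0 ?sqr_ge0 // ltW.
Qed.

(** By induction on the degree, from V = W - (w - 1) V: the bound d tau
    reproduces itself because tau + d rho tau = tau + (d - 1)(tau - 1) << d tau. *)
Lemma dominated_div_near1 (K : R) V W w : 0 <= K -> V * w = W ->
  dominated (mabs W) (K *: tau) -> dominated (mabs (w - 1)) rho ->
  dominated (mabs V) ((K * d) *: tau).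
Proof.
move=> K0 VW Wtau wrho Q; have [k] := ubnP (mdeg Q); elim: k Q => // k IHk Q.
rewrite ltnS => leQ; have VE : V = W - (w - 1) * V by rewrite -VW; ring.
have step : cmod (((w - 1) * V) Q) <= K * d * (rho * tau) Q.
  rewrite !(smulM _ _ (ltnSn _)) mulr_sumr; apply: le_trans (cmod_sum _ _ _) _.
  apply: ler_sum => P lePQ; rewrite cmodM.
  have [P0|P0] := posnP (mdeg P).
    have -> : cmod ((w - 1) P) = 0.
      apply/eqP; rewrite eq_le cmod_ge0 andbT -(rho1 (Q := P)) ?P0 //.
      exact: wrho.
    by rewrite mul0r !mulr_ge0 // ltW.
  rewrite mulrCA ler_pM ?cmod_ge0 //; first exact: wrho.
  by apply: IHk; apply: leq_trans leQ; apply: mdeg_subm_lt.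
rewrite /mabs VE; apply: le_trans (cmodB _ _) _.
apply: le_trans (lerD (Wtau Q) step) _.
rewrite tauE !sscaleE saddE soppE -!mulrA -mulrDr ler_wpM2l //.
have one0 : 0 <= (1 : series R n) Q := nonneg1 Q.
have -> : d * (t * (tau Q - (1 : series R n) Q)) =
   (d - 1) * (tau Q - (1 : series R n) Q) by field; rewrite gt_eqF.
have : 0 <= (d - 1) * (1 : series R n) Q by rewrite mulr_ge0 // subr_ge0 ltW.
lra.
Qed.

Lemma dominated_smonom_near1 (w : 'I_n -> series R[i] n) P :
  (forall j, dominated (mabs (w j - 1)) rho) ->
  dominated (mabs (smonom w P)) (d ^+ mdeg P *: tau).
Proof.
move=> wrho; elim/(@mnm_ind n): P => [|j P IHP].
  by rewrite smonom0 mabs1 mdeg0 scale1r; apply: dominated1_tau.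
rewrite smonomD smonomU mulrC mdegD mdeg1 addnC exprD expr1.
by apply: dominated_mul_near1 => //; rewrite exprn_ge0 // ltW.
Qed.

Lemma dominated_smonom_inv_near1 (v w : 'I_n -> series R[i] n) P :
  (forall j, v j * w j = 1) -> (forall j, dominated (mabs (w j - 1)) rho) ->
  dominated (mabs (smonom v P)) (d ^+ mdeg P *: tau).
Proof.
move=> vw wrho; elim/(@mnm_ind n): P => [|j P IHP].
  by rewrite smonom0 mabs1 mdeg0 scale1r; apply: dominated1_tau.
rewrite smonomD smonomU mdegD mdeg1 addnC exprD expr1.
apply: (@dominated_div_near1 _ _ (smonom v P) (w j)) => //.
  by rewrite exprn_ge0 // ltW.
by rewrite mulrAC vw mul1r.
Qed.

End GeometricMajorant.

Section GeometricExists.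
Context {R : realType} {n : nat}.

Lemma geometric_majorant (t : R) (rho : series R n) :
  0 < t -> nonneg rho -> order_ge 1 rho ->
  exists tau, nonneg tau /\ rho * tau = t *: (tau - 1).
Proof.
move=> t0 rho_ge0 rho1.
have [//|//|tau [_ tauE]] := @geometric_series R n (fun=> True) (t^-1 *: rho).
  exact: order_geZ.
exists tau; split; last first.
  by rewrite {2}tauE addrAC subrr add0r -sscaleAl scalerA mulfV ?gt_eqF // scale1r.
move=> Q; have [k] := ubnP (mdeg Q); elim: k Q => // k IHk Q.
rewrite ltnS => leQ; rewrite tauE saddE addr_ge0 ?nonneg1 //.
rewrite (smulM _ _ (ltnSn _)); apply: sumr_ge0 => P lePQ; rewrite sscaleE.
have [P0|P0] := posnP (mdeg P); first by rewrite rho1 ?P0 // mulr0 mul0r.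
apply: mulr_ge0; first by rewrite mulr_ge0 ?invr_ge0 // ltW.
by apply: IHk; apply: leq_trans leQ; apply: mdeg_subm_lt.
Qed.

Lemma psum_geometric k r (t : R) (rho tau : series R n) : 0 <= r -> 0 < t ->
  nonneg rho -> nonneg tau -> rho * tau = t *: (tau - 1) ->
  psum k r rho <= t / 2 ->
  psum k r tau <= 2 /\ psum k r (tau - 1) <= 2 / t * psum k r rho.
Proof.
move=> r0 t0 rho0 tau0 tauE le_rho.
have tau1E : tau - 1 = t^-1 *: (rho * tau).
  by rewrite tauE scalerA mulVf ?gt_eqF // scale1r.
have le1 : psum k r (tau - 1) <= t^-1 * (psum k r rho * psum k r tau).
  rewrite tau1E psumZ ler_wpM2l ?invr_ge0 ?(ltW t0) //.
  exact: psum_mul.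
have psum1_le : psum k r (1 : series R n) <= 1.
  by apply: le_trans (le_psum_index (leqnSn k) r0 (@nonneg1 R n)) _; rewrite psum1.
have tauge0 : 0 <= psum k r tau by apply: psum_ge0.
have rhoge0 : 0 <= psum k r rho by apply: psum_ge0.
have tau_split : psum k r tau = psum k r (1 : series R n) + psum k r (tau - 1).
  by rewrite -psumD addrC subrK.
have le_half : t^-1 * (psum k r rho * psum k r tau) <= psum k r tau / 2.
  rewrite mulrA [leRHS]mulrC ler_wpM2r //.
  by rewrite mulrC ler_pdivrMr // mulrC.
have tau2 : psum k r tau <= 2 by lra.
split=> //; apply: le_trans le1 _.
rewrite [2 / t]mulrC -mulrA ler_wpM2l ?invr_ge0 ?(ltW t0) //.
by rewrite [leRHS]mulrC ler_wpM2l.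
Qed.

End GeometricExists.

(** * Small divisors *)

Section SmallDivisors.
Context {R : realType}.

(** The witness is the inverse of 1 plus the sum of the inverses: unlike a
    minimum, it also makes sense when T is empty. *)
Lemma finite_pos_lower_bound (T : finType) (a : T -> R) :
  (forall x, 0 < a x) -> exists2 e, 0 < e & forall x, e <= a x.
Proof.
move=> a0; exists (1 + \sum_x (a x)^-1)^-1.
  by rewrite invr_gt0 ltr_pwDl // sumr_ge0 // => x _; rewrite invr_ge0 ltW.
move=> x; rewrite -[leRHS]invrK lef_pV2 ?posrE ?invr_gt0 //; last first.
  by rewrite ltr_pwDl // sumr_ge0 // => y _; rewrite invr_ge0 ltW.
rewrite (bigD1 x) //= addrCA lerDl addr_ge0 // sumr_ge0 // => y _.
by rewrite invr_ge0 ltW.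
Qed.

Lemma finite_upper_bound (T : finType) (a : T -> R) :
  exists2 M, 0 <= M & forall x, a x <= M.
Proof.
exists (\sum_x `|a x|); first by apply: sumr_ge0.
move=> x; rewrite (bigD1 x) //=; apply: le_trans (ler_norm _) _.
by rewrite lerDl sumr_ge0.
Qed.

(** Bernoulli's inequality. *)
Lemma expr_unbounded (d D : R) : 1 < d -> exists q0, forall q, (q0 <= q)%N ->
  D <= d ^+ q.
Proof.
move=> d1; have e0 : 0 < d - 1 by rewrite subr_gt0.
have d0 : 0 <= d by rewrite ltW // (lt_trans ltr01).
have bern q : 1 + (d - 1) *+ q <= d ^+ q.
  elim: q => [|q IHq]; first by rewrite mulr0n addr0.
  rewrite exprS; apply: le_trans (ler_wpM2l d0 IHq).
  rewrite mulrS -subr_ge0.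
  have -> : d * (1 + (d - 1) *+ q) - (1 + (d - 1 + (d - 1) *+ q)) =
     (d - 1) * ((d - 1) *+ q) by ring.
  by rewrite mulr_ge0 ?mulrn_wge0 // ltW.
exists (Num.Def.truncn (`|D| / (d - 1))).+1 => q leq.
apply: le_trans (ler_norm _) _; apply: le_trans (bern q).
apply: ler_wpDl => //.
have : `|D| / (d - 1) <= q%:R.
  apply: le_trans (ltW (truncnS_gt _)) _; by rewrite ler_nat.
by rewrite ler_pdivrMr // mulr_natl.
Qed.

Context {n l : nat} (mu : 'M[R[i]]_(l, n)).
Hypothesis mu_neq0 : forall m j, mu m j != 0.

Lemma eigmonom_neq0 m Q : eigmonom mu m Q != 0.
Proof. by apply/prodf_neq0 => j _; rewrite expf_neq0. Qed.

(** For |Q| large, either growth hypothesis puts mu_m^Q far below or far above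
    mu_mj; only finitely many Q remain, and their divisors do not vanish. *)
Lemma small_divisor_bound (d c : R) : 1 < d -> 0 < c ->
  exists2 e, 0 < e & forall m j Q, eigmonom mu m Q != mu m j ->
    (c^-1 * d ^+ mdeg Q < (cmod (eigmonom mu m Q))^-1 ->
       e <= cmod (eigmonom mu m Q - mu m j)) /\
    (c^-1 * d ^+ mdeg Q < cmod (eigmonom mu m Q) ->
       e <= cmod (1 - mu m j / eigmonom mu m Q)).
Proof.
move=> d1 c0; have d0 : 0 < d := lt_trans ltr01 d1.
have [a a0 amu] := @finite_pos_lower_bound ('I_l * 'I_n)%type
  (fun x => cmod (mu x.1 x.2)) (fun x => etrans (cmod_gt0 _) (mu_neq0 _ _)).
have [M M0 muM] := @finite_upper_bound ('I_l * 'I_n)%type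
  (fun x => cmod (mu x.1 x.2)).
have [q0 dq0] := expr_unbounded (2 * c / a + 2 * c * M) d1.
pose u m Q := eigmonom mu m Q.
pose f (x : 'I_l * 'I_n * 'X_{1..n < q0}) : R :=
  if u x.1.1 x.2 == mu x.1.1 x.1.2 then 1 else
  Num.min (cmod (u x.1.1 x.2 - mu x.1.1 x.1.2))
          (cmod (1 - mu x.1.1 x.1.2 / u x.1.1 x.2)).
have [b b0 bf] : exists2 b, 0 < b & forall x, b <= f x.
  apply: finite_pos_lower_bound => -[[m j] Q]; rewrite /f /=.
  case: eqVneq => [//|neq]; rewrite lt_min !cmod_gt0 subr_eq0 neq /=.
  rewrite subr_eq0 eq_sym; apply: contra neq => /eqP mu1.
  by rewrite -[mu m j](divfK (eigmonom_neq0 m Q)) mu1 mul1r.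
have ha : 0 < a / 2 by rewrite divr_gt0.
have hh : 0 < 1 / 2 :> R by rewrite divr_gt0.
exists (Num.min b (Num.min (a / 2) (1 / 2))); first by rewrite !lt_min b0 ha hh.
move=> m j Q neq; have [ltQ|leQ] := ltnP (mdeg Q) q0.
  have := bf (m, j, BMultinom ltQ); rewrite /f /= (negPf neq) le_min.
  by move=> /andP[b1 b2]; split=> _; rewrite ge_min ?b1 ?b2.
have u0 : 0 < cmod (u m Q) by rewrite cmod_gt0 eigmonom_neq0.
have D2 : 0 <= 2 * c / a by rewrite divr_ge0 ?mulr_ge0 // ltW.
have D3 : 0 <= 2 * c * M by rewrite !mulr_ge0 // ltW.
have := dq0 _ leQ; move: (d ^+ mdeg Q) => D leD; split=> lt.
- rewrite !ge_min; apply/orP; right; apply/orP; left.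
  have ua : cmod (u m Q) <= a / 2.
    rewrite -[leLHS]invrK -[leRHS]invrK lef_pV2 ?posrE ?invr_gt0 //.
    apply: le_trans (ltW lt); rewrite invf_div [leRHS]mulrC ler_pdivlMr //.
    by rewrite mulrAC; lra.
  have := amu (m, j) => /= mua.
  have := cmodD (u m Q - mu m j) (- u m Q).
  rewrite addrAC subrr add0r !cmodN => h.
  lra.
rewrite !ge_min; apply/orP; right; apply/orP; right.
have uM : cmod (mu m j / u m Q) <= 1 / 2.
  rewrite cmodM cmodV ler_pdivrMr //; apply: le_trans (muM (m, j)) _.
  have : M <= 1 / 2 * (c^-1 * D).
    have -> : 1 / 2 * (c^-1 * D) = D / (2 * c) by field; rewrite gt_eqF.
    by rewrite ler_pdivlMr ?mulr_gt0 //; lra.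
  lra.
have := cmodD (1 - mu m j / u m Q) (mu m j / u m Q).
rewrite subrK cmod1; lra.
Qed.

End SmallDivisors.

(** * The majorant inequality for the normalizing map *)

Section KeyInequality.
Context {R : realType} {n l : nat} (mu : 'M[R[i]]_(l, n)).
Context (F : 'I_l -> smap R[i] n).
Local Notation C := R[i].
Implicit Types (Q : 'X_{1..n}).
Hypothesis F_linear : forall m, linear_part (F m) = diag_mx (row m mu).
Hypothesis mu_neq0 : forall m j, mu m j != 0.
Hypothesis F0 : forall m, fixes_origin (F m).
Context (Phi Psi : smap C n) (nu : 'I_l -> smap C n).
Hypothesis norm : normalizes mu F Phi Psi nu.
Hypothesis nonres : forall j Q, resonant mu j Q -> Phi j Q = svar j Q.

Definition unit_factor m j := (mu m j)^-1 *: nu m j.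
Definition factor_majorant : series R n :=
  \sum_m \sum_j mabs (unit_factor m j - 1).
Definition perturbation j : series R n :=
  \sum_m mabs (scomp (nonlinear_part (F m j)) Phi).
Local Notation rho := factor_majorant.

Lemma nonneg_factor_majorant : nonneg rho.
Proof. by do 2!apply: nonneg_sum => ? _; apply: nonneg_mabs. Qed.

Lemma order_ge_factor_majorant : order_ge 1 rho.
Proof.
do 2!apply: order_ge_sum => ? _; apply: order_ge_mabs => Q.
rewrite ltnS leqn0 mdeg_eq0 => /eqP ->.
case: norm => _ _ nu0 _ _.
by rewrite saddE soppE /unit_factor sscaleE nu0 mulVf // sone_E eqxx subrr.
Qed.

Lemma unit_factor_dominated m j : dominated (mabs (unit_factor m j - 1)) rho.
Proof.
move=> Q; rewrite /rho ssumE (bigD1 m) //= ssumE (bigD1 j) //= -addrA lerDl.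
apply: addr_ge0; first by apply: sumr_ge0 => k _; apply: nonneg_mabs.
apply: sumr_ge0 => k _; rewrite ssumE; apply: sumr_ge0 => k' _.
exact: nonneg_mabs.
Qed.

Lemma nonneg_perturbation j : nonneg (perturbation j).
Proof. by apply: nonneg_sum => m _; apply: nonneg_mabs. Qed.

Lemma order_ge_perturbation j : order_ge 2 (perturbation j).
Proof.
case: norm => -[Phi0 _ _] _ _ _ _.
apply: order_ge_sum => m _; apply/order_ge_mabs/order_ge_scomp => //.
exact: order_ge_nonlinear_part.
Qed.

Lemma perturbation_ge m j Q :
  cmod (scomp (nonlinear_part (F m j)) Phi Q) <= perturbation j Q.
Proof.
rewrite /perturbation ssumE (bigD1 m) //= lerDl.
by apply: sumr_ge0 => k _; apply: nonneg_mabs.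
Qed.

Lemma smonom_nuE m P :
  smonom (nu m) P = eigmonom mu m P *: smonom (unit_factor m) P.
Proof.
rewrite /unit_factor smonom_scale scalerA -big_split big1 ?scale1r // => j _ /=.
by rewrite -exprMn mulfV // expr1n.
Qed.

Section Bound.
Context (d c e : R) (tau : series R n).
Hypotheses (d_gt1 : 1 < d) (c_gt0 : 0 < c) (e_gt0 : 0 < e).
Hypotheses (tau_ge0 : nonneg tau) (tauE : rho * tau = (1 - d^-1) *: (tau - 1)).
Hypothesis small_divisors : forall m j Q, eigmonom mu m Q != mu m j ->
    (c^-1 * d ^+ mdeg Q < (cmod (eigmonom mu m Q))^-1 ->
       e <= cmod (eigmonom mu m Q - mu m j)) /\
    (c^-1 * d ^+ mdeg Q < cmod (eigmonom mu m Q) ->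
       e <= cmod (1 - mu m j / eigmonom mu m Q)).
Hypothesis poincare : forall (j : 'I_n) (Q : 'X_{1..n}),
      (exists m, eigmonom mu m Q - mu m j != 0) ->
      exists (i : 'I_l) (Q' : 'X_{1..n}),
        [/\ forall k, eigmonom mu k Q' = eigmonom mu k Q,
            eigmonom mu i Q' - mu i j != 0,
            c^-1 * d ^+ mdeg Q' <
              Num.max (cmod (eigmonom mu i Q')) (cmod (eigmonom mu i Q')^-1)
          & (Q <= Q')%MM \/ (Q' <= Q)%MM].

Let tau_ge1 : dominated 1 tau.
Proof.
exact: (dominated1_tau d_gt1 nonneg_factor_majorant tau_ge0 tauE).
Qed.

Lemma dominated_sub_const (K : R) (U : series C n) : 0 <= K ->
  dominated (mabs U) (K *: tau) ->
  dominated (mabs (U - U 0%MM *: (1 : series C n))) (K *: (tau - 1)).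
Proof.
move=> K0 Utau Q; rewrite /mabs !saddE !soppE !sscaleE !saddE soppE !sone_E.
have [->|Q0] := eqVneq Q 0%MM.
  rewrite mulr1 subrr cmod0 mulr_ge0 // subr_ge0.
  by have := tau_ge1 0%MM; rewrite sone_E eqxx.
by rewrite mulr0 !subr0; apply: Utau.
Qed.

Lemma tau_mul_ge (a : series R n) Q : nonneg a -> a Q <= (tau * a) Q.
Proof.
move=> a0; rewrite -{1}[a]mul1r; apply: dominatedM => //; exact: nonneg1.
Qed.

(** Here U = nu_i^Q' has constant term u = mu_i^Q' and U << c tau, and the
    coefficient equation is
    (u - mu_ij) [Phi_j]_Q = [f_i,j o Phi]_Q - [(U - u) Phi_j]_Q. *)
Lemma small_eigenvalue_bound i j Q Q' :
  eigmonom mu i Q' != mu i j ->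
  (forall m, smonom (nu m) Q' = smonom (nu m) Q) ->
  c^-1 * d ^+ mdeg Q' < (cmod (eigmonom mu i Q'))^-1 ->
  e * cmod (Phi j Q) <=
    (tau * perturbation j) Q + c * ((tau - 1) * mabs (Phi j)) Q.
Proof.
set u := eigmonom mu i Q' => neq eqQ lt.
have [/(_ lt) le_e _] := small_divisors neq.
have u_neq0 : u != 0 by apply: eigmonom_neq0.
have U_dom : dominated (mabs (smonom (nu i) Q')) (c *: tau).
  rewrite smonom_nuE mabsZ => P; rewrite !sscaleE.
  apply: (@le_trans _ _ (cmod u * (d ^+ mdeg Q' * tau P))).
    rewrite ler_wpM2l ?cmod_ge0 //.
    exact: (dominated_smonom_near1 d_gt1 nonneg_factor_majorant tau_ge0 tauE
      _ (unit_factor_dominated i)).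
  rewrite mulrA ler_wpM2r // mulrC -ler_pdivlMr ?cmod_gt0 //.
  by rewrite -ler_pdivrMl // ltW.
set U := smonom (nu i) Q' in U_dom.
have U0 : U 0%MM = u.
  case: norm => _ _ nu0 _ _; rewrite /U smonom_at0 /u /eigmonom.
  by apply: eq_bigr => k _; rewrite nu0.
have eqn := conjugacy_coef F_linear mu_neq0 F0 norm i j Q.
rewrite -eqQ -/U in eqn.
have solve : (u - mu i j) * Phi j Q =
    scomp (nonlinear_part (F i j)) Phi Q -
    ((U - U 0%MM *: (1 : series C n)) * Phi j) Q.
  rewrite [(U - _) * _]mulrBl saddE soppE eqn -sscaleAl mul1r sscaleE U0.
  ring.
apply: le_trans (ler_wpM2r (cmod_ge0 _) le_e) _.
rewrite -cmodM solve; apply: le_trans (cmodB _ _) _; apply: lerD.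
  apply: le_trans (perturbation_ge i j Q) _.
  exact/tau_mul_ge/nonneg_perturbation.
apply: le_trans (mabsM _ _ Q) _.
rewrite -sscaleE sscaleAl; apply: dominatedM => //; try exact: nonneg_mabs.
exact: dominated_sub_const (ltW c_gt0) U_dom.
Qed.

(** The coefficient equation is first multiplied by the invariant series
    Y = nu_i^(-Q') << c tau.  This is legitimate because it holds with the same
    factor nu_i^Q' at all the exponents Q - P with P invariant. *)
Lemma large_eigenvalue_bound i j Q Q' :
  eigmonom mu i Q' != mu i j ->
  (forall m, smonom (nu m) Q' = smonom (nu m) Q) ->
  c^-1 * d ^+ mdeg Q' < cmod (eigmonom mu i Q') ->
  e * cmod (Phi j Q) <= c * (tau * perturbation j) Q +
    cmod (mu i j) * c * ((tau - 1) * mabs (Phi j)) Q.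
Proof.
set u := eigmonom mu i Q' => neq eqQ lt.
have [_ /(_ lt) le_e] := small_divisors neq.
have u_neq0 : u != 0 by apply: eigmonom_neq0.
have inv_factor k : exists v, invariant_series mu v /\ v * unit_factor i k = 1.
  case: norm => _ _ nu0 nui _.
  have [||v [vi vE _]] := @invariant_inverse _ _ _ mu (unit_factor i k).
  - by apply: has_charZ; apply: nui.
  - by rewrite /unit_factor sscaleE nu0 mulVf ?oner_neq0.
  by exists v.
have [v vP] := choice inv_factor.
pose Y := u^-1 *: smonom v Q'.
have Yinv : invariant_series mu Y.
  by apply/has_charZ/invariant_smonom => k; case: (vP k).
have Y_dom : dominated (mabs Y) (c *: tau).
  rewrite mabsZ => P; rewrite !sscaleE cmodV.
  apply: (@le_trans _ _ ((cmod u)^-1 * (d ^+ mdeg Q' * tau P))).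
    rewrite ler_wpM2l ?invr_ge0 ?cmod_ge0 //.
    apply: (dominated_smonom_inv_near1 d_gt1 nonneg_factor_majorant
      order_ge_factor_majorant tau_ge0 tauE _ _ (unit_factor_dominated i)).
    by move=> k; case: (vP k).
  rewrite mulrA ler_wpM2r // mulrC ler_pdivrMr ?cmod_gt0 //.
  by rewrite -ler_pdivrMl // ltW.
set U := smonom (nu i) Q'.
have YU : Y * U = 1.
  rewrite /Y /U smonom_nuE -sscaleAl -sscaleAr scalerA mulVf // scale1r.
  elim/(@mnm_ind n): Q' {Y Yinv Y_dom U neq eqQ lt le_e u_neq0 u} => [|k P IHP].
    by rewrite !smonom0 mulr1.
  by rewrite !smonomD mulrACA IHP !smonomU mulr1; case: (vP k).
have Y0 : Y 0%MM = u^-1.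
  rewrite /Y sscaleE smonom_at0.
  rewrite big1 ?mulr1 // => k _.
  have [_ /(congr1 (fun f : series C n => f 0%MM))] := vP k.
  case: norm => _ _ nu0 _ _.
  rewrite smul_at0 sone_E eqxx /unit_factor sscaleE nu0 mulVf // mulr1 => ->.
  by rewrite expr1n.
have eqn : Phi j Q =
    (Y * (mu i j *: Phi j + scomp (nonlinear_part (F i j)) Phi)) Q.
  rewrite -{1}[Phi j]mul1r -YU -mulrA !(smulM _ _ (ltnSn _)).
  apply: eq_bigr => -[P /= _] lePQ.
  have [->|YP] := eqVneq (Y P) 0; first by rewrite !mul0r.
  have invP := Yinv _ YP; congr (_ * _); rewrite saddE sscaleE.
  rewrite -(conjugacy_coef F_linear mu_neq0 F0 norm) /U eqQ.
  rewrite (@smonom_comparable _ _ _ mu F mu_neq0 _ _ _ norm Q (Q - P)%MM) //.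
    by move=> m; rewrite -{1}(submK lePQ) eigmonomD invP mulr1.
  by right; apply: lem_subr.
have solve : (1 - mu i j / u) * Phi j Q =
    (Y * scomp (nonlinear_part (F i j)) Phi) Q +
    mu i j * ((Y - Y 0%MM *: (1 : series C n)) * Phi j) Q.
  rewrite mulrBl mul1r {1}eqn mulrDr saddE -sscaleAr sscaleE.
  rewrite [(Y - _) * _]mulrBl saddE soppE -(sscaleAl _ 1) mul1r sscaleE Y0.
  ring.
apply: le_trans (ler_wpM2r (cmod_ge0 _) le_e) _.
rewrite -cmodM solve; apply: le_trans (cmodD _ _) _; apply: lerD.
  apply: le_trans (mabsM _ _ Q) _.
  rewrite -sscaleE sscaleAl; apply: dominatedM => //; try exact: nonneg_mabs.
  exact: perturbation_ge.
rewrite cmodM -mulrA ler_wpM2l ?cmod_ge0 //.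
apply: le_trans (mabsM _ _ Q) _.
rewrite -sscaleE sscaleAl; apply: dominatedM => //; try exact: nonneg_mabs.
exact: dominated_sub_const (ltW c_gt0) Y_dom.
Qed.

Lemma key_inequality (M : R) j :
  (forall i k, cmod (mu i k) <= M) -> 0 <= M ->
  dominated (mabs (Phi j)) (svar j +
    (e^-1 * (1 + c + M * c)) *: (tau * perturbation j + (tau - 1) * mabs (Phi j))).
Proof.
move=> muM M0 Q.
have a0 : 0 <= (tau * perturbation j) Q.
  by apply: nonnegM => //; apply: nonneg_perturbation.
have tau1 : nonneg (tau - 1).
  by move=> P; rewrite saddE soppE subr_ge0; apply: tau_ge1.
have b0 : 0 <= ((tau - 1) * mabs (Phi j)) Q.
  by apply: nonnegM => //; apply: nonneg_mabs.
rewrite saddE sscaleE saddE.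
set a := (tau * perturbation j) Q in a0 *.
set b := ((tau - 1) * mabs (Phi j)) Q in b0 *.
have Mc0 : 0 <= M * c by rewrite mulr_ge0 // ltW.
have K0 : 0 <= 1 + c + M * c by rewrite !addr_ge0 // ltW.
have [res|nres] := pselect (resonant mu j Q).
  rewrite /mabs nonres // svarE.
  have -> : cmod ((Q == U_(j)%MM)%:R : C) = (Q == U_(j)%MM)%:R.
    by case: eqP; rewrite ?cmod0 ?cmod1.
  by rewrite lerDl !mulr_ge0 ?addr_ge0 ?invr_ge0 // ltW.
have [m neq] : exists m, eigmonom mu m Q - mu m j != 0.
  apply: contra_notP nres => nex m; apply/eqP; rewrite -subr_eq0.
  by apply: contraT => neq; case: nex; exists m.
have [i [Q' [eqQ neqQ' lt cmp]]] := poincare (ex_intro _ m neq).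
rewrite subr_eq0 in neqQ'.
have nuQ k : smonom (nu k) Q' = smonom (nu k) Q.
  by apply: (smonom_comparable mu_neq0 norm) => //; case: cmp; [right|left].
suff le_ab : e * cmod (Phi j Q) <= (1 + c + M * c) * (a + b).
  rewrite /mabs -mulrA; apply: ler_wpDl; first by rewrite svarE ler0n.
  by rewrite mulrC ler_pdivlMr // mulrC.
have ca0 : 0 <= c * a by rewrite mulr_ge0 // ltW.
have cb0 : 0 <= c * b by rewrite mulr_ge0 // ltW.
have Mca0 : 0 <= M * c * a by rewrite mulr_ge0.
have Mcb0 : 0 <= M * c * b by rewrite mulr_ge0.
move: lt; rewrite lt_max cmodV => /orP[lt|lt].
  apply: le_trans (large_eigenvalue_bound neqQ' nuQ lt) _.
  rewrite -/a -/b.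
  have : cmod (mu i j) * c * b <= M * c * b.
    by rewrite -!mulrA ler_wpM2r // muM.
  lra.
apply: le_trans (small_eigenvalue_bound neqQ' nuQ lt) _.
rewrite -/a -/b; lra.
Qed.

End Bound.
End KeyInequality.

(** * Convergence *)

Section Convergence.
Context {R : realType} {n : nat}.
Local Notation C := R[i].
Implicit Types (f g h : series C n) (G Phi Psi : smap C n) (a : series R n).

Lemma psum_mul_svar k r a j : 0 <= r -> nonneg a ->
  psum k r a * r <= psum k.+1 r (a * svar j).
Proof.
move=> r0 a0.
have ltS (Q : 'X_{1..n < k}) : (mdeg (Q + U_(j))%MM < k.+1)%N.
  by rewrite mdegD mdeg1 addn1 ltnS bmdeg.
pose w Q : 'X_{1..n < k.+1} := BMultinom (ltS Q).
have winj : injective w.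
  by move=> P Q /(congr1 val) /= /addIm h; apply: val_inj.
have aj0 : nonneg (a * svar j) by apply: nonnegM => // Q; apply: ler0n.
rewrite /psum mulr_suml.
rewrite (eq_bigr (fun Q : 'X_{1..n < k} =>
  (a * svar j) (w Q) * r ^+ mdeg (w Q))) => [|Q _]; last first.
  by rewrite /= -smonU smul_smon mdegD mdeg1 exprD expr1 mulrA.
rewrite -(big_imset (fun Q : 'X_{1..n < k.+1} => (a * svar j) Q * r ^+ mdeg Q)
  (in2W winj)) /=.
rewrite [leRHS](bigID (mem (w @: predT))) /= lerDl.
by apply: sumr_ge0 => Q _; rewrite mulr_ge0 ?exprn_ge0.
Qed.

(** The gain of a factor r over the radius 2 r of the values of G is what closes
    the induction for small r. *)
Lemma psum_comp_quadratic k r s0 M0 h G : 0 < r -> 0 < s0 -> 2 * r <= s0 ->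
  fixes_origin G -> order_ge 2 h -> (forall k, psum k s0 (mabs h) <= M0) ->
  (forall j, psum k r (mabs (G j)) <= 2 * r) ->
  psum k.+1 r (mabs (scomp h G)) <= 4 * M0 / s0 ^+ 2 * r ^+ 2.
Proof.
move=> r0 s0_gt0 rs G0 h2 hM Gr.
apply: le_trans (psum_comp (ltW r0) G0 h2 Gr) _.
have r2 : 0 <= 2 * r by rewrite mulr_ge0 // ltW.
apply: le_trans (psum_order2 _ r2 rs s0_gt0 (nonneg_mabs _) (order_ge_mabs h2)) _.
apply: le_trans (ler_wpM2l (sqr_ge0 _) (hM _)) _.
by rewrite le_eqVlt; apply/orP; left; apply/eqP; field; rewrite gt_eqF.
Qed.

Lemma convergent_uniform (T : finType) (f : T -> series C n) :
  (forall x, convergent (f x)) -> exists s0 M0,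
    [/\ 0 < s0, 0 <= M0 & forall x k, psum k s0 (mabs (f x)) <= M0].
Proof.
move=> fC.
have /choice[rM rMP] : forall x, exists rM : R * R, 0 < rM.1 /\
    forall k, psum k rM.1 (mabs (f x)) <= rM.2.
  by move=> x; have [r [M ?]] := fC x; exists (r, M).
have [s0 s0_gt0 les0] := finite_pos_lower_bound (fun x => (rMP x).1).
have [M0 M0_ge0 leM0] := finite_upper_bound (fun x => (rM x).2).
exists s0, M0; split=> // x k; apply: le_trans (leM0 x).
apply: le_trans ((rMP x).2 k); apply: ler_sum => Q _.
rewrite ler_wpM2l ?cmod_ge0 //; apply: lerXn2r; rewrite ?nnegrE ?les0 //.
  exact: ltW.
exact/ltW/(rMP x).1.
Qed.

(** Psi = z - f(Psi), where f is the nonlinear part of Phi; the bound 2 r on the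
    partial sums of Psi propagates from each degree to the next. *)
Lemma convergent_inverse Phi Psi : fixes_origin Phi -> fixes_origin Psi ->
  linear_part Phi = 1%:M -> smap_comp Phi Psi =2 svar ->
  (forall j, convergent (Phi j)) -> forall j, convergent (Psi j).
Proof.
move=> Phi0 Psi0 Phi1 PP PhiC.
have PsiE j : Psi j = svar j - scomp (nonlinear_part (Phi j)) Psi.
  have -> : svar j = scomp (Phi j) Psi by apply/funext => Q; rewrite -PP.
  rewrite scomp_nonlinear_part // Phi0 scale0r add0r addrK (bigD1 j) //= big1 ?addr0.
    by have /matrixP/(_ j j) := Phi1; rewrite !mxE eqxx => ->; rewrite scale1r.
  move=> i ij; have /matrixP/(_ j i) := Phi1; rewrite !mxE eq_sym (negPf ij) => ->.
  by rewrite scale0r.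
have [s0 [M0 [s0_gt0 M0_ge0 hM]]] :=
  convergent_uniform (fun j => convergent_nonlinear_part (PhiC j)).
pose K := 4 * M0 / s0 ^+ 2.
have K0 : 0 <= K by rewrite divr_ge0 ?mulr_ge0 ?exprn_ge0 // ltW.
have s2 : 0 < 2 / s0 by rewrite divr_gt0.
(* Both 2 r <= s0 and K r <= 1 hold for this r. *)
pose r := (2 / s0 + K)^-1.
have T0 : 0 < 2 / s0 + K by rewrite ltr_pwDl.
have r0 : 0 < r by rewrite invr_gt0.
have rs : 2 * r <= s0.
  rewrite ler_pdivrMr // mulrDr mulrCA divff ?gt_eqF // mulr1 lerDl.
  by rewrite mulr_ge0 // ltW.
have rK : K * r <= 1 by rewrite ler_pdivrMr // mul1r lerDr ltW.
have bound k j : psum k r (mabs (Psi j)) <= 2 * r.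
  elim: k j => [|k IHk] j.
    rewrite /psum big1 ?mulr_ge0 ?ltW // => Q _; by case: Q.
  apply: (@le_trans _ _ (psum k.+1 r
    (svar j + mabs (scomp (nonlinear_part (Phi j)) Psi)))).
    apply: le_psum (ltW r0) _ => Q _; rewrite {1}PsiE -mabs_svar.
    exact: cmodB.
  rewrite psumD [leRHS](_ : _ = r + r); last by ring.
  apply: lerD; first exact/psum_svar/ltW.
  apply: le_trans (psum_comp_quadratic r0 s0_gt0 rs Psi0 _ (hM j) IHk) _.
    exact: order_ge_nonlinear_part.
  by rewrite -/K expr2 mulrA ler_piMl // ltW.
by move=> j; exists r, (2 * r); split=> // k; apply: bound.
Qed.

End Convergence.

Section Bootstrap.
Context {R : realType} {n l : nat} (mu : 'M[R[i]]_(l, n)).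
Context (F : 'I_l -> smap R[i] n).
Local Notation C := R[i].
Implicit Types (Q : 'X_{1..n}).
Hypothesis F_linear : forall m, linear_part (F m) = diag_mx (row m mu).
Hypothesis mu_neq0 : forall m j, mu m j != 0.
Hypothesis F0 : forall m, fixes_origin (F m).
Context (Phi Psi : smap C n) (nu : 'I_l -> smap C n).
Hypothesis norm : normalizes mu F Phi Psi nu.
Hypothesis nonres : forall j Q, resonant mu j Q -> Phi j Q = svar j Q.
Local Notation rho := (factor_majorant mu nu).

(** The exponent Q = P + U_j is resonant when P is invariant, so z_j is the only
    term of Phi_j that contributes to [nu_mj Phi_j]_Q, and [Phi_j]_Q = 0. *)
Lemma nu_bound m j P : P != 0%MM ->
  cmod (nu m j P) <= cmod (scomp (nonlinear_part (F m j)) Phi (P + U_(j))%MM).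
Proof.
move=> P0; case: (norm) => _ _ nu0 nui nures.
have [->|nuP] := eqVneq (nu m j P) 0; first by rewrite cmod0 cmod_ge0.
have invP := nui _ _ _ nuP; set Q := (P + U_(j))%MM.
have resQ : resonant mu j Q by move=> m'; rewrite eigmonomD invP mul1r eigmonomU.
have Qpos : (0 < mdeg Q)%N by rewrite mdegD mdeg1 addn1.
have := conjugacy_coef F_linear mu_neq0 F0 norm m j Q.
rewrite (nures j) // nonres // svarE -{1}[U_(j)%MM]add0m eqm_add2r (negPf P0).
rewrite mulr0 add0r => <-; suff -> : (nu m j * Phi j) Q = nu m j P by [].
transitivity ((nu m j * svar j) Q); last by rewrite -smonU smul_smon.
rewrite !(smulM _ _ (ltnSn _)); apply: eq_bigr => -[A /= _] leAQ.
have [->|nuA] := eqVneq (nu m j A) 0; first by rewrite !mul0r.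
rewrite nonres // => m'; rewrite -(resQ m') -[in RHS](submK leAQ) eigmonomD.
by rewrite (nui _ _ _ nuA) mulr1.
Qed.

Lemma unit_factor_psum k r m j : 0 <= r ->
  psum k r (mabs (unit_factor mu nu m j - 1)) * r <=
  (cmod (mu m j))^-1 * psum k.+1 r (mabs (scomp (nonlinear_part (F m j)) Phi)).
Proof.
move=> r0; apply: le_trans (psum_mul_svar k j r0 (nonneg_mabs _)) _.
rewrite -psumZ; apply: le_psum => // Q _; rewrite sscaleE -cmodV.
have [leQ|nleQ] := boolP (U_(j) <= Q)%MM; last first.
  by rewrite -smonU smul_smon0 // mulr_ge0 ?cmod_ge0.
rewrite -(submK leQ) -smonU smul_smon /mabs; set P := (Q - U_(j))%MM.
rewrite saddE soppE /unit_factor sscaleE sone_E.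
have [P0|P0] := eqVneq P 0%MM.
  case: norm => _ _ nu0 _ _.
  by rewrite P0 nu0 mulVf // subrr cmod0 mulr_ge0 ?cmod_ge0.
by rewrite subr0 cmodM ler_wpM2l ?cmod_ge0 // nu_bound.
Qed.

Lemma linear_part_nonresonant : linear_part Phi = 1%:M.
Proof.
case: (norm) => -[Phi0 _ _] _ nu0 nui _.
rewrite -linear_part_id; apply/matrixP => j k; rewrite !mxE.
have [res|nres] := pselect (resonant mu j U_(k)%MM); first exact: nonres.
have -> : svar j U_(k)%MM = 0 :> C.
  rewrite svarE; case: eqP => // e; case: nres => m.
  by rewrite e eigmonomU.
apply/eqP; apply: contra_notT nres => Phijk m.
have := conjugacy_coef F_linear mu_neq0 F0 norm m j U_(k)%MM.
rewrite (order_ge_scomp Phi0 (order_ge_nonlinear_part (F m j))) ?mdeg1 // addr0.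
rewrite smonomU (smulM (k := 2)) ?mdeg1 //.
rewrite (bigD1 (BMultinom (bm0_proof n 1))) /=; last first.
  by apply/mnm_lepP => i; rewrite mnm0E.
rewrite subm0 nu0 big1 ?addr0; first by move/(mulIf Phijk); rewrite eigmonomU.
move=> [A ltA] /andP[leA]; rewrite -val_eqE /= -mdeg_eq0 -lt0n => A0.
have -> : (U_(k) - A)%MM = 0%MM.
  apply/eqP; rewrite -mdeg_eq0 -leqn0 -ltnS.
  by have := mdeg_subm_lt leA A0; rewrite mdeg1.
by rewrite Phi0 mulr0.
Qed.

(** The radius r is the inverse of a sum of three terms, chosen so that
    respectively 2 r lies in the domain of the nonlinear parts, the geometric
    series tau converges at r, and the right-hand side of the majorant inequality
    exceeds r by at most r. *)
Lemma bootstrap (d s0 M0 M : R) (tau : series R n) :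
  1 < d -> 0 < s0 -> 0 <= M0 -> 0 <= M ->
  (forall m j k, psum k s0 (mabs (nonlinear_part (F m j))) <= M0) ->
  nonneg tau -> rho * tau = (1 - d^-1) *: (tau - 1) ->
  (forall j, dominated (mabs (Phi j)) (svar j +
    M *: (tau * perturbation F Phi j + (tau - 1) * mabs (Phi j)))) ->
  exists2 r, 0 < r & forall k, (forall j, psum k r (mabs (Phi j)) <= 2 * r) /\
    psum k r rho <= 1.
Proof.
move=> d1 s0_gt0 M0_ge0 M_ge0 hM tau_ge0 tauE key.
case: (norm) => -[Phi0 _ _] _ _ _ _.
have d0 : 0 < d := lt_trans ltr01 d1.
set t := 1 - d^-1 in tauE.
have t0 : 0 < t by rewrite subr_gt0 invf_lt1.
have t1 : t <= 1 by rewrite gerBl invr_ge0 ltW.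
pose K := 4 * M0 / s0 ^+ 2.
have K0 : 0 <= K by rewrite divr_ge0 ?mulr_ge0 ?exprn_ge0 // ltW.
pose S := \sum_m \sum_j (cmod (mu m j))^-1.
have S0 : 0 <= S.
  by apply: sumr_ge0 => m _; apply: sumr_ge0 => j _; rewrite invr_ge0 cmod_ge0.
pose T1 := 2 / s0; pose T2 := K * S * 2 / t.
pose T3 := M * (2 * (K *+ l) + 4 / t * (K * S)).
have T1_gt0 : 0 < T1 by rewrite divr_gt0.
have KS0 : 0 <= K * S by apply: mulr_ge0.
have T2_ge0 : 0 <= T2.
  apply: divr_ge0; last exact: ltW.
  by apply: mulr_ge0.
have T3_ge0 : 0 <= T3.
  apply: mulr_ge0 => //; apply: addr_ge0; apply: mulr_ge0 => //.
    exact: mulrn_wge0.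
  by apply: divr_ge0 => //; apply: ltW.
pose r := (T1 + T2 + T3)^-1.
have T_gt0 : 0 < T1 + T2 + T3 by rewrite -addrA ltr_pwDl // addr_ge0.
have r0 : 0 < r by rewrite invr_gt0.
have Tr T : 0 <= T -> T <= T1 + T2 + T3 -> T * r <= 1.
  by move=> T0 leT; rewrite ler_pdivrMr // mul1r.
have T1r : T1 * r <= 1 by apply: Tr; [apply: ltW|lra].
have T2r : T2 * r <= 1 by apply: Tr => //; lra.
have T3r : T3 * r <= 1 by apply: Tr => //; lra.
have rs : 2 * r <= s0.
  by move: T1r; rewrite /T1 mulrAC ler_pdivrMr // mul1r.
have rKS : K * S * r <= t / 2.
  rewrite ler_pdivlMr // -[leRHS]mul1r -ler_pdivrMr //.
  by move: T2r; rewrite /T2; lra.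
have nonlinear_bound k m j : (forall j, psum k r (mabs (Phi j)) <= 2 * r) ->
    psum k.+1 r (mabs (scomp (nonlinear_part (F m j)) Phi)) <= K * r ^+ 2.
  move=> IH; apply: (psum_comp_quadratic r0 s0_gt0 rs Phi0 _ (hM m j) IH).
  exact: order_ge_nonlinear_part.
have rho_bound k : (forall j, psum k r (mabs (Phi j)) <= 2 * r) ->
    psum k r rho <= K * S * r.
  move=> IH; rewrite /factor_majorant psum_sum /S mulr_sumr mulr_suml.
  apply: ler_sum => m _; rewrite psum_sum mulr_sumr mulr_suml.
  apply: ler_sum => j _; rewrite -(ler_pM2r r0).
  apply: le_trans (unit_factor_psum _ _ _ (ltW r0)) _.
  apply: le_trans (ler_wpM2l _ (nonlinear_bound k m j IH)) _.
    by rewrite invr_ge0 cmod_ge0.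
  rewrite le_eqVlt; apply/orP; left; apply/eqP; ring.
have rho_ge0 := nonneg_factor_majorant mu nu.
have rho1 := order_ge_factor_majorant mu_neq0 norm.
have tau1_ge0 : nonneg (tau - 1).
  move=> Q; rewrite saddE soppE subr_ge0.
  exact: (dominated1_tau d1 rho_ge0 tau_ge0 tauE).
have tau1_order : order_ge 1 (tau - 1).
  have -> : tau - 1 = t^-1 *: (rho * tau).
    by rewrite tauE scalerA mulVf ?gt_eqF // scale1r.
  apply: order_geZ; rewrite -[1%N]addn0.
  exact: (order_geM rho1 (@order_ge0 _ _ tau)).
have main k j : psum k r (mabs (Phi j)) <= 2 * r.
  elim: k j => [|k IHk] j.
    rewrite /psum big1 ?mulr_ge0 ?ltW // => Q _; by case: Q.
  have [tau2 tau1] := psum_geometric (ltW r0) t0 rho_ge0 tau_ge0 tauE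
    (le_trans (rho_bound k IHk) rKS).
  apply: le_trans (le_psum (ltW r0) (fun Q _ => key j Q)) _.
  rewrite psumD psumZ psumD [leRHS](_ : _ = r + r); last by ring.
  apply: lerD; first exact/psum_svar/ltW.
  have pert_ge0 := nonneg_perturbation F Phi j.
  have pert1 := order_geW (leqnSn 1) (order_ge_perturbation norm j).
  have b1 : psum k.+1 r (tau * perturbation F Phi j) <= 2 * (K *+ l * r ^+ 2).
    have := psumM k.+1 (ltW r0) tau_ge0 pert_ge0 (@order_ge0 _ _ tau) pert1.
    rewrite subSS !subn0 => /le_trans; apply.
    apply: ler_pM => //; try exact/psum_ge0/nonneg_perturbation/ltW.
      by apply: psum_ge0 => //; apply: ltW.
    rewrite /perturbation psum_sum.
    apply: (@le_trans _ _ (\sum_(m < l) K * r ^+ 2)).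
      by apply: ler_sum => m _; apply: nonlinear_bound.
    by rewrite sumr_const card_ord mulrnAl.
  have b2 : psum k.+1 r ((tau - 1) * mabs (Phi j)) <=
      2 / t * (K * S * r) * (2 * r).
    have Phi_order : order_ge 1 (mabs (Phi j)).
      by apply: order_ge_mabs; apply: ((fixes_originP Phi).1 Phi0).
    have := psumM k.+1 (ltW r0) tau1_ge0 (nonneg_mabs _) tau1_order Phi_order.
    rewrite subSS !subn0 => /le_trans; apply.
    apply: ler_pM => //; try exact/psum_ge0/nonneg_mabs/ltW.
      by apply: psum_ge0 => //; apply: ltW.
    apply: le_trans tau1 _; rewrite ler_wpM2l ?rho_bound //.
    by rewrite divr_ge0 // ltW.
  apply: le_trans (ler_wpM2l M_ge0 (lerD b1 b2)) _.
  rewrite [leLHS](_ : _ = T3 * r * r); last by rewrite /T3; ring.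
  by rewrite ler_piMl // ltW.
exists r => // k; split=> [j|]; first exact: main.
apply: le_trans (rho_bound k (main k)) _.
by apply: le_trans rKS _; lra.
Qed.

End Bootstrap.

Theorem theorem1p2 (R : realType) (n l : nat)
    (F : 'I_l -> smap R[i] n) (mu : 'M[R[i]]_(l, n))
    (F_biholo : forall m, biholomorphic_germ (F m))
    (F_linear : forall m, linear_part (F m) = diag_mx (row m mu))
    (F_formal : formally_completely_integrable F)
    (D_poincare : poincare_type mu) :
  holomorphically_completely_integrable F.
Proof.
have F0 m : fixes_origin (F m) by case: (F_biholo m).
have mu_neq0 m j : mu m j != 0.
  have [_ _ [G [G0 _ [FG _]]]] := F_biholo m.
  have /matrixP/(_ j j) := inverse_linear_part (F0 m) G0 FG.
  rewrite F_linear mul_diag_mx !mxE eqxx => muG.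
  by apply: contra_eq_neq muG => ->; rewrite mul0r eq_sym oner_neq0.
have [Phi0 [Psi0 [nu0 norm0]]] := integrable_normalizes F_linear F_formal.
have [Phi [Psi [nu [norm nonres]]]] :=
  nonresonant_normalization F_linear F0 norm0.
have [d [c [d1 c0 poincare]]] := D_poincare.
have [e e0 divisors] := small_divisor_bound mu_neq0 d1 c0.
have t0 : 0 < 1 - d^-1 by rewrite subr_gt0 invf_lt1 // (lt_trans ltr01).
have [tau [tau_ge0 tauE]] := geometric_majorant t0
  (nonneg_factor_majorant mu nu) (order_ge_factor_majorant mu_neq0 norm).
have [M M0 muM] := @finite_upper_bound R ('I_l * 'I_n)%type
  (fun x => cmod (mu x.1 x.2)).
have key j := key_inequality F_linear mu_neq0 F0 norm nonres d1 c0 e0 tau_ge0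
  tauE divisors poincare j (fun m k => muM (m, k)) M0.
have [s0 [M1 [s0_gt0 M1_ge0 hM]]] := @convergent_uniform R n ('I_l * 'I_n)%type
  (fun x => nonlinear_part (F x.1 x.2))
  (fun x => convergent_nonlinear_part
     (let: And3 _ h _ := F_biholo x.1 in h x.2)).
have K0 : 0 <= e^-1 * (1 + c + M * c).
  by rewrite mulr_ge0 ?invr_ge0 ?addr_ge0 ?mulr_ge0 // ltW.
have [r r0 bound] := bootstrap F_linear mu_neq0 F0 norm nonres d1
  s0_gt0 M1_ge0 K0 (fun m j k => hM (m, j) k) tau_ge0 tauE key.
have PhiC j : convergent (Phi j).
  by exists r, (2 * r); split=> // k; apply: (bound k).1.
have [[PhiO PsiO [PP _]] _ _ _ _] := norm.
apply: (normalizes_integrable F_linear norm) => [j|m j].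
  split=> //; apply: (convergent_inverse PhiO PsiO _ PP PhiC).
  exact: (linear_part_nonresonant F_linear mu_neq0 F0 norm nonres).
exists r, (cmod (mu m j) * 2); split=> // k.
apply: (@le_trans _ _ (psum k r (cmod (mu m j) *: (1 + factor_majorant mu nu)))).
  apply: (@le_psum _ _ k r (mabs (nu m j)) _ (ltW r0)) => Q _; rewrite /mabs sscaleE.
  rewrite [nu m j](_ : _ = mu m j *: unit_factor mu nu m j); last first.
    by rewrite scalerA mulfV // scale1r.
  rewrite sscaleE cmodM ler_wpM2l ?cmod_ge0 //.
  have -> : unit_factor mu nu m j = 1 + (unit_factor mu nu m j - 1).
    by rewrite addrC subrK.
  apply: le_trans (cmodD _ _) _; apply: lerD.
    by rewrite -[cmod _]/(mabs 1 Q) mabs1.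
  exact: unit_factor_dominated.
rewrite psumZ psumD ler_wpM2l ?cmod_ge0 // [2](_ : _ = 1 + 1) // lerD //.
  apply: le_trans (le_psum_index (leqnSn k) (ltW r0) (@nonneg1 R n)) _.
  by rewrite psum1.
exact: (bound k).2.
Qed.
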